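(* Let $E\subset\mathbb R^n$ be a compact set, $\alpha>0$, $\upsilon\ge\Upsilon(E)$, $\mu\in U_\upsilon(E)$, let $f=\{f_j\}_{|j|\le\alpha}\in \mathrm{Lip}_\alpha(E)$, and let $q>\upsilon+\alpha$. Let $\mathcal E(f)=\mathcal E_{q,\alpha}(f)$, a $C^\infty$ function on $\mathbb R^n\setminus E$. Then for any $R>0$ the function $g$ defined by $$g(x)=\begin{cases} f(x), & x\in E,\\ \mathcal E(f)(x), & x\notin E,\end{cases}$$ lies in $\mathrm{Lip}_\alpha(B(0,R))$; here $g$ is understood as the jet $\{g_j\}_{|j|\le\alpha}$ with $g_j=f_j$ on $E$ and $g_j=D^j\mathcal E(f)$ off $E$.
   Context: On $\mathbb R^n$ use $d(x,y)=|x-y|$. For a metric space $(X,d)$ of finite diameter, $x\in X$, $R>0$, $k\ge1$, let $N(x,R,k)$ be the maximum number of points in $B(x,kR)$ separated by a distance $\ge R$. Write $(X,d)\in\Upsilon_\gamma$ if there is $C$ with $N(x,R,k)\le Ck^\gamma$ for all $x\in X$, $0<R<kR\le1$; the upper dimension is $\Upsilon(X)=\inf\{\gamma:(X,d)\in\Upsilon_\gamma\}$. A probability measure $\mu$ on $X$ lies in $U_\gamma(X)$ if there is $C$ with $\mu(B(x,kR))\le Ck^\gamma\mu(B(x,R))$ for all $x\in X$, $0<R<kR\le 1$. A jet on a set $F\subset\mathbb R^n$ is a collection $f=\{f_j\}_{|j|\le\alpha}$ ($j\in\mathbb N^n$ multiindices) of continuous functions on $F$. Its Taylor polynomial is $T^\alpha_yf(x)=\sum_{|j|\le\alpha}\frac1{j!}f_j(y)(x-y)^j$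 ($y\in F$, $x\in\mathbb R^n$), and $\Delta_j(y,x)=f_j(x)-D^j_xT^\alpha_yf(x)$. $\mathrm{Lip}_\alpha(F)$ is the set of jets with finite norm $$\|f\|_{\mathrm{Lip}_\alpha(F)}=\sum_{|j|\le\alpha}\Big(\|f_j\|_{\infty,F}+\sup_{x,y\in F}\frac{|\Delta_j(y,x)|}{d(x,y)^{\alpha-|j|}}\Big).$$ For $x\in\mathbb R^n\setminus E$: $h_q(x)=\int_E|x-y|^{-q}\,d\mu(y)$ and $$\mathcal E_{q,\alpha}(f)(x)=\frac1{h_q(x)}\int_E\frac{T^\alpha_yf(x)}{|x-y|^q}\,d\mu(y).$$
   Formalization: Formal version assumes the support of μ is E (every ball centred on E has positive measure), and for integer α does not claim continuity of g_j with |j|=α; the Lip_α norm bound at all orders |j|≤α is kept. The English fails without these changes. *)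

(* Defs.v *)
From HB Require Import structures.
From mathcomp Require Import all_boot all_order all_algebra.
From mathcomp Require Import all_classical all_reals all_analysis.

Set Implicit Arguments.
Unset Strict Implicit.
Unset Printing Implicit Defensive.
Import Order.TTheory GRing.Theory Num.Theory.
Import numFieldNormedType.Exports.
Local Open Scope classical_set_scope.
Local Open Scope ring_scope.

(** * Metric dimension and homogeneous measures

The metric space is a subset [X] of a carrier [T] with the induced distance;
balls are open, and the dilation factor [k] is real. *)

Section MetricSpaces.
Context {R : realType} {T : Type} (dist : T -> T -> R).

Definition mball (x : T) (r : R) : set T := [set y | dist x y < r].

(* [p] is injective as soon as [0 < r], so [m] counts distinct points. *)
Definition separated_number (X : set T) (x : T) (r k : R) : \bar R :=
  ereal_sup [set (m%:R)%:E | m in [set m : nat |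
    exists p : 'I_m -> T,
      (forall i, X (p i) /\ mball x (k * r) (p i)) /\
      (forall i j, i != j -> r <= dist (p i) (p j))]].

Definition Upsilon_class (X : set T) (g : R) : Prop :=
  exists C : R, forall (x : T) (r k : R),
    X x -> 0 < r -> r < k * r -> k * r <= 1 ->
    (separated_number X x r k <= (C * k `^ g)%:E)%E.

Definition upper_dim (X : set T) : \bar R :=
  ereal_inf [set g%:E | g in [set g : R | Upsilon_class X g]].

End MetricSpaces.

Definition U_class {R : realType} {d : measure_display} {T : measurableType d}
    (dist : T -> T -> R) (X : set T) (mu : set T -> \bar R) (g : R) : Prop :=
  exists C : R, forall (x : T) (r k : R),
    X x -> 0 < r -> r < k * r -> k * r <= 1 ->
    (mu (X `&` mball dist x (k * r)) <=
       (C * k `^ g)%:E * mu (X `&` mball dist x r))%E.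

(** * Euclidean space *)

(* The norm supplied by the library on ['rV[R]_n] is the maximum norm. *)
Definition eucl_norm {R : realType} {n : nat} (x : 'rV[R]_n) : R :=
  Num.sqrt (\sum_(i < n) x ord0 i ^+ 2).

Definition eucl_dist {R : realType} {n : nat} (x y : 'rV[R]_n) : R := eucl_norm (x - y).

Definition borel (R : realType) (n : nat) :=
  g_sigma_algebraType (@open 'rV[R]_n).

(** * Multi-indices and partial derivatives *)

Definition multiindex (n : nat) := {ffun 'I_n -> nat}.

Section MultiIndex.
Context {n : nat}.

Definition mdegree (j : multiindex n) : nat := (\sum_(i < n) j i)%N.

Definition mfactorial (j : multiindex n) : nat := (\prod_(i < n) (j i)`!)%N.

Definition mpower {R : realType} (x : 'rV[R]_n) (j : multiindex n) : R :=
  \prod_(i < n) x ord0 i ^+ j i.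

(* A finite set, so that the sums below are genuine finite sums. *)
Definition mindices {R : realType} (a : R) : set (multiindex n) :=
  [set j | (mdegree j)%:R <= a].

End MultiIndex.

Section PartialDerivatives.
Context {R : realType} {n : nat}.

Definition partial (i : 'I_n) (f : 'rV[R]_n -> R) : 'rV[R]_n -> R :=
  fun x => 'D_(delta_mx ord0 i) f x.

Definition partials (s : seq 'I_n) (f : 'rV[R]_n -> R) : 'rV[R]_n -> R :=
  foldr partial f s.

Definition Dmulti (j : multiindex n) : ('rV[R]_n -> R) -> 'rV[R]_n -> R :=
  partials (flatten [seq nseq (j i) i | i <- enum 'I_n]).

Definition smooth_on (U : set 'rV[R]_n) (f : 'rV[R]_n -> R) : Prop :=
  forall (s : seq 'I_n) (x : 'rV[R]_n), U x ->
    {for x, continuous (partials s f)} /\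
    (forall i : 'I_n, derivable (partials s f) x (delta_mx ord0 i)).

End PartialDerivatives.

(** * Jets and Lipschitz spaces

A jet of order [a] on [F] is a family indexed by all multi-indices, of which
only the members of degree at most [a], restricted to [F], are ever used. *)

Section Jets.
Context {R : realType} {n : nat}.
Implicit Types (a : R) (F : set 'rV[R]_n) (f : multiindex n -> 'rV[R]_n -> R).

Definition taylor a f (y x : 'rV[R]_n) : R :=
  \sum_(j \in mindices a) (mfactorial j)%:R^-1 * f j y * mpower (x - y) j.

Definition remainder a f (j : multiindex n) (y x : 'rV[R]_n) : R :=
  f j x - Dmulti j (taylor a f y) x.

Definition is_jet a F f : Prop :=
  forall j, mindices a j -> {within F, continuous (f j)}.

(* On the diagonal [x = y] the remainder vanishes, so the quotient is [0]
   there, whatever the value of the denominator. *)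
Definition lip_norm a F f : \bar R :=
  (\sum_(j \in mindices a)
     (ereal_sup [set `|f j x|%:E | x in F] +
      ereal_sup [set (`|remainder a f j y x| /
                      eucl_dist x y `^ (a - (mdegree j)%:R))%:E
                | x in F & y in F]))%E.

Definition Lip a F f : Prop := is_jet a F f /\ (lip_norm a F f < +oo)%E.

End Jets.

(** * The extension operator *)

Section Extension.
Context {R : realType} {n : nat}.
Variables (E : set 'rV[R]_n) (mu : probability (borel R n) R) (q a : R).

Definition h_kernel (x : 'rV[R]_n) : R :=
  \int[mu]_(y in E) (eucl_dist x y `^ (- q)).

Definition extension (f : multiindex n -> 'rV[R]_n -> R) (x : 'rV[R]_n) : R :=
  (h_kernel x)^-1 * \int[mu]_(y in E) (taylor a f y x / eucl_dist x y `^ q).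

Definition extended_jet (f : multiindex n -> 'rV[R]_n -> R)
    (j : multiindex n) (x : 'rV[R]_n) : R :=
  if x \in E then f j x else Dmulti j (extension f) x.

End Extension.

(* Main.v *)
Require Import Defs.
From HB Require Import structures.
From mathcomp Require Import all_boot all_order all_algebra.
From mathcomp Require Import all_classical all_reals all_analysis.
From mathcomp Require Import measurable_realfun ring lra.
Set Implicit Arguments.
Unset Strict Implicit.
Import Order.TTheory GRing.Theory Num.Theory.
Import numFieldNormedType.Exports.
Local Open Scope classical_set_scope.
Local Open Scope ring_scope.

(** Let [d] be the distance from [x] to [E] and [e] a nearest point of [E].
Since [mu] is homogeneous of exponent [upsilon < q - alpha], summing over dyadic
shells around [e] gives [\int |x - y|^(alpha - q) <= C d^alpha h(x)]. Together
with the Lipschitz condition, which makes the Taylor polynomials [T_y - T_e]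
of size [|x - y|^alpha] near [x], and with the product and quotient rules, this
yields [|D^j (ext - T_e)(x)| <= C d^(alpha - |j|)] for all [j], also for [|j|]
larger than [alpha].

For the remainder between [x] and [y] at distance [r] there are then two cases.
If both points are within [4 r] of [E], one passes from the jet at [x] to the one
at [y] through the Taylor polynomials at the nearest points of [E]. If [y] is
farther than [3 r] from [E], the extension is smooth on the ball of radius [r]
around [y] and the bound on its derivatives of order [floor(alpha) + 1] controls
the Taylor remainder. *)

(** * Euclidean geometry *)

(** Derivatives are taken along coordinate axes only, so every passage from a derivative bound to an
    increment uses the one-variable mean value theorem along axis-parallel segments. Symmetry of
    mixed partials then allows the multi-index of a jet to be replaced by any sequence of axes.

    The normalisation by [h] costs nothing, although the size of [h] near [E] is unknown: each
    kernel [|x - y|^-q] dominates its own weighted derivatives, hence so does its integral [h], and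
    the quotient rule only needs bounds relative to the value of [h]. The measure enters through the
    ratio of two moments, from which the mass of the ball around the nearest point cancels.

    For [|j| = alpha] the remainder estimate has exponent zero and gives boundedness but no
    continuity. Continuity of [g j] is therefore obtained for [|j| < alpha], and these are all the
    members of the jet when [alpha] is not a natural number. *)

Section EuclideanNorm.
Context {R : realType} {n : nat}.
Implicit Types (x y z : 'rV[R]_n) (r t : R) (i : 'I_n).

Lemma eucl_norm_ge0 x : 0 <= eucl_norm x.
Proof. exact: sqrtr_ge0. Qed.

Lemma eucl_norm_sqr x : eucl_norm x ^+ 2 = \sum_(i < n) x ord0 i ^+ 2.
Proof. by rewrite sqr_sqrtr// sumr_ge0// => i _; exact: sqr_ge0. Qed.

Lemma eucl_norm_le x y :
  (forall i, `|x ord0 i| <= `|y ord0 i|) -> eucl_norm x <= eucl_norm y.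
Proof.
move=> xy; apply: ler_wsqrtr; apply: ler_sum => i _.
by rewrite -(real_normK (num_real (x _ _))) -(real_normK (num_real (y _ _))) lerXn2r// nnegrE.
Qed.

Lemma coord_le_eucl_norm x i : `|x ord0 i| <= eucl_norm x.
Proof.
rewrite -[leLHS]sqrtr_sqr; apply: ler_wsqrtr.
by rewrite (bigD1 i)//= lerDl sumr_ge0// => j _; exact: sqr_ge0.
Qed.

Lemma eucl_norm0 : eucl_norm (0 : 'rV[R]_n) = 0.
Proof. by rewrite /eucl_norm big1 ?sqrtr0// => i _; rewrite mxE expr0n. Qed.

Lemma eucl_norm0_eq0 x : eucl_norm x = 0 -> x = 0.
Proof.
move=> x0; apply/rowP => i; rewrite mxE; apply/eqP.
by rewrite -normr_le0 -x0 coord_le_eucl_norm.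
Qed.

Lemma eucl_normN x : eucl_norm (- x) = eucl_norm x.
Proof. by congr Num.sqrt; apply: eq_bigr => i _; rewrite mxE sqrrN. Qed.

Lemma eucl_norm_scale_delta t i : eucl_norm (t *: delta_mx ord0 i : 'rV[R]_n) = `|t|.
Proof.
rewrite /eucl_norm (bigD1 i)//= big1 ?addr0 => [|j /negPf ji].
  by rewrite !mxE !eqxx mulr1 sqrtr_sqr.
by rewrite !mxE ji andbF mulr0 expr0n.
Qed.

(** Cauchy-Schwarz: with [a = |x|] and [b = |y|], the sum of the squares [(b x_i - a y_i)^2] equals
    [2ab (ab - <x, y>)]. *)
Lemma sum_mul_le_eucl_norm x y :
  \sum_(i < n) x ord0 i * y ord0 i <= eucl_norm x * eucl_norm y.
Proof.
have [/eqP/eucl_norm0_eq0 ->|x0] := boolP (eucl_norm x == 0).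
  by rewrite eucl_norm0 mul0r big1// => i _; rewrite mxE mul0r.
have [/eqP/eucl_norm0_eq0 ->|y0] := boolP (eucl_norm y == 0).
  by rewrite eucl_norm0 mulr0 big1// => i _; rewrite mxE mulr0.
set a := eucl_norm x in x0 *; set b := eucl_norm y in y0 *.
have a0 : 0 < a by rewrite lt_def x0 eucl_norm_ge0.
have b0 : 0 < b by rewrite lt_def y0 eucl_norm_ge0.
have : 0 <= \sum_(i < n) (b * x ord0 i - a * y ord0 i) ^+ 2.
  by apply: sumr_ge0 => i _; exact: sqr_ge0.
rewrite (eq_bigr (fun i => b ^+ 2 * x ord0 i ^+ 2 + a ^+ 2 * y ord0 i ^+ 2 -
   2 * a * b * (x ord0 i * y ord0 i))); last by move=> i _; ring.
rewrite sumrB big_split/= -!mulr_sumr -!eucl_norm_sqr -/a -/b => H.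
have ab : 0 < 2 * (a * b) by rewrite mulr_gt0// mulr_gt0.
rewrite -(ler_pM2l ab); lra.
Qed.

Lemma ler_eucl_normD x y : eucl_norm (x + y) <= eucl_norm x + eucl_norm y.
Proof.
rewrite -ler_sqr ?nnegrE ?addr_ge0 ?eucl_norm_ge0// sqrrD !eucl_norm_sqr.
have := sum_mul_le_eucl_norm x y.
have -> : \sum_(i < n) (x + y) ord0 i ^+ 2 =
    \sum_(i < n) (x ord0 i ^+ 2 + y ord0 i ^+ 2 + 2 * (x ord0 i * y ord0 i)).
  by apply: eq_bigr => i _; rewrite mxE; ring.
by rewrite !big_split/= -mulr_sumr; lra.
Qed.

Lemma eucl_dist_ge0 x y : 0 <= eucl_dist x y.
Proof. exact: eucl_norm_ge0. Qed.

Lemma eucl_distC x y : eucl_dist x y = eucl_dist y x.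
Proof. by rewrite /eucl_dist -opprB eucl_normN. Qed.

Lemma eucl_distxx x : eucl_dist x x = 0.
Proof. by rewrite /eucl_dist subrr eucl_norm0. Qed.

Lemma eucl_dist_gt0 x y : (0 < eucl_dist x y) = (x != y).
Proof.
have [->|xy] := eqVneq x y; first by rewrite eucl_distxx ltxx.
rewrite lt_def eucl_dist_ge0 andbT; apply: contra xy => /eqP/eucl_norm0_eq0/eqP.
by rewrite subr_eq0.
Qed.

Lemma eucl_dist_triangle y x z : eucl_dist x z <= eucl_dist x y + eucl_dist y z.
Proof. by rewrite /eucl_dist (le_trans _ (ler_eucl_normD _ _))// subrKA. Qed.

Lemma eucl_dist_axis x t i : eucl_dist (t *: delta_mx ord0 i + x) x = `|t|.
Proof. by rewrite /eucl_dist addrK eucl_norm_scale_delta. Qed.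

Lemma eucl_norm_continuous : continuous (@eucl_norm R n).
Proof.
have sqr_cts : continuous (fun x : 'rV[R]_n => \sum_(i < n) x ord0 i ^+ 2).
  apply: continuous_big => [|i _]; first exact: add_continuous.
  move=> x; apply: (@continuous_comp _ _ _ (fun x : 'rV[R]_n => x ord0 i)
    (fun t => t ^+ 2)); [exact: coord_continuous|exact: exprn_continuous].
move=> x; apply: (@continuous_comp _ _ _ (fun x : 'rV[R]_n => \sum_(i < n) x ord0 i ^+ 2)
  (@Num.sqrt R)); [exact: sqr_cts|exact: sqrt_continuous].
Qed.

Lemma eucl_dist_continuousl y : continuous (fun x => eucl_dist x y).
Proof.
move=> x; apply: (@continuous_comp _ _ _ (fun x : 'rV[R]_n => x - y) eucl_norm).
  by apply: (@continuousB _ _ _ id (cst y)); [move=> ? |exact: cst_continuous].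

exact: eucl_norm_continuous.
Qed.

Lemma eucl_dist_continuousr x : continuous (fun y => eucl_dist x y).
Proof.
rewrite (_ : (fun y => _) = eucl_dist^~ x); first exact: eucl_dist_continuousl.
by apply/funext => y; rewrite eucl_distC.
Qed.

Lemma near_eucl_dist x r : 0 < r -> \forall y \near x, eucl_dist y x < r.
Proof.
move=> r0; have := @eucl_dist_continuousl x x.
by move/cvgr_lt; apply; rewrite eucl_distxx.
Qed.

Lemma nbhs_eucl_ball (A : set 'rV[R]_n) x : nbhs x A ->
  exists2 r, 0 < r & forall y, eucl_dist y x <= r -> A y.
Proof.
move=> /nbhs_ballP[r /= r0 rA]; exists (r / 2); first by rewrite divr_gt0.
move=> y yx; apply: rA; split => // i j; rewrite /= -ball_normE /= (ord1 i) distrC.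
rewrite (le_lt_trans _ (_ : r / 2 < r)) ?ltr_pdivrMr ?ltr_pMr ?ltr1n// (le_trans _ yx)//.
by have := coord_le_eucl_norm (y - x) j; rewrite !mxE.
Qed.

Lemma open_eucl_ball (U : set 'rV[R]_n) x : open U -> U x ->
  exists2 r, 0 < r & forall y, eucl_dist y x <= r -> U y.
Proof. by move=> oU Ux; apply: nbhs_eucl_ball; exact: open_nbhs_nbhs. Qed.

End EuclideanNorm.

(** * Calculus with iterated partial derivatives *)

Section AxisDerivatives.
Context {R : realType} {n : nat}.
Implicit Types (f g u v : 'rV[R]_n -> R) (x y z : 'rV[R]_n) (i : 'I_n) (s : seq 'I_n).
Implicit Types (U : set 'rV[R]_n).

Lemma is_derive_line f x (v : 'rV[R]_n) (t : R) : derivable f (t *: v + x) v ->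
  is_derive t 1 (fun t => f (t *: v + x)) ('D_v f (t *: v + x)).
Proof.
move=> df; have E : (fun h : R => h^-1 *: (((fun t => f (t *: v + x)) \o shift t) (h *: 1) -
    f (t *: v + x))) = (fun h => h^-1 *: ((f \o shift (t *: v + x)) (h *: v) - f (t *: v + x))).
  by apply/funext => h /=; rewrite [_%:A]mulr1 scalerDl addrA.
by split; rewrite /derivable /derive E.
Qed.

(** Only [|r| <= |t|] is recorded about the intermediate point, so that a single statement serves
    both signs of [t]. *)
Lemma axis_mvt f x i (t : R) :
  (forall r : R, `|r| <= `|t| -> derivable f (r *: delta_mx ord0 i + x) (delta_mx ord0 i)) ->
  exists2 r, `|r| <= `|t| &
    f (t *: delta_mx ord0 i + x) - f x = t * partial i f (r *: delta_mx ord0 i + x).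
Proof.
move=> df; set e := delta_mx ord0 i.
have dphi (r : R) : `|r| <= `|t| ->
    is_derive r 1 (fun r => f (r *: e + x)) (partial i f (r *: e + x)).
  by move=> rt; apply: is_derive_line; exact: df.
have cphi (a b : R) : (forall r : R, r \in `[a, b] -> `|r| <= `|t|) ->
    {within `[a, b], continuous (fun r => f (r *: e + x))}.
  move=> ab; apply: derivable_within_continuous => r /ab rt.
  by have [] := dphi _ rt.
have [t0|t0] := leP 0 t.
  have st (r : R) : r \in `[0, t] -> `|r| <= `|t|.
    by rewrite in_itv/= => /andP[r0 rt]; rewrite !ger0_norm.
  have [|c /st ct] := @MVT_segment R (fun r => f (r *: e + x))
    (fun r => partial i f (r *: e + x)) 0 t t0 _ (cphi _ _ st).
    by move=> r rt; apply: dphi; apply: st; exact: subset_itv_oo_cc rt.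
  by rewrite scale0r add0r subr0 mulrC => E; exists c.
have st (r : R) : r \in `[t, 0] -> `|r| <= `|t|.
  by rewrite in_itv/= => /andP[rt r0]; rewrite !ler0_norm ?lerN2// ltW.
have [|c /st ct] := @MVT_segment R (fun r => f (r *: e + x))
    (fun r => partial i f (r *: e + x)) t 0 (ltW t0) _ (cphi _ _ st).
  by move=> r rt; apply: dphi; apply: st; exact: subset_itv_oo_cc rt.
rewrite scale0r add0r sub0r mulrN => E; exists c => //.
by rewrite mulrC -[RHS]opprK -E opprB.
Qed.

Lemma near_open U x : open U -> U x -> \forall z \near x, U z.
Proof. by move=> oU Ux; exact: open_nbhs_nbhs. Qed.

Lemma partials_cat s t f : partials (s ++ t) f = partials s (partials t f).
Proof. exact: foldr_cat. Qed.

(** The last axis of the sequence acts first. Induction from the right thus strips the innermost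
    derivative, and the product and quotient rules can be applied to [partial i f] before the
    remaining derivatives. *)
Lemma partials_rcons s i f : partials (rcons s i) f = partials s (partial i f).
Proof. by rewrite -cats1 partials_cat. Qed.

Lemma eq_partials U f g : open U -> (forall x, U x -> f x = g x) ->
  forall s x, U x -> partials s f x = partials s g x.
Proof.
move=> oU fg; elim=> [|i s IH] x Ux; first exact: fg.
apply: near_eq_derive; near=> z; apply: IH; near: z; exact: near_open.
Unshelve. all: by end_near. Qed.

(* [smooth_upto m U] is the order-[m] truncation of [smooth_on U]; it is what
   the product and quotient rules can be proved for by induction on [m]. *)
Definition smooth_upto (m : nat) U f := forall s x, (size s <= m)%N -> U x ->
  {for x, continuous (partials s f)} /\
  (forall i, derivable (partials s f) x (delta_mx ord0 i)).

Lemma smooth_uptoP U f : smooth_on U f <-> forall m, smooth_upto m U f.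
Proof.
split=> [sf m s x _ Ux|sf s x Ux]; first exact: sf.
exact: (sf (size s)).
Qed.

Lemma smooth_uptoS m U f :
  smooth_upto m.+1 U f <-> smooth_upto 0 U f /\ forall i, smooth_upto m U (partial i f).
Proof.
split=> [sf|[sf0 sf] s x].
  split=> [s x|i s x ss Ux]; first by rewrite leqn0 => /nilP ->; exact: sf.
  by rewrite -partials_rcons; apply: sf; rewrite ?size_rcons.
case/lastP: s => [_|s i]; first exact: sf0.
by rewrite size_rcons ltnS partials_rcons; exact: sf.
Qed.

Lemma smooth_upto_le m k U f : (k <= m)%N -> smooth_upto m U f -> smooth_upto k U f.
Proof. by move=> km sf s x sk; apply: sf; exact: leq_trans sk km. Qed.

Lemma smooth_partials U s f : smooth_on U f -> smooth_on U (partials s f).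
Proof. by move=> sf t x Ux; rewrite -partials_cat; exact: sf. Qed.

Lemma smooth_partial U i f : smooth_on U f -> smooth_on U (partial i f).
Proof. exact: (@smooth_partials _ [:: i]). Qed.

Lemma smooth_subset U (V : set 'rV[R]_n) f : V `<=` U -> smooth_on U f -> smooth_on V f.
Proof. by move=> VU sf s x /VU; exact: sf. Qed.

Lemma smooth_continuous U f x : smooth_on U f -> U x -> {for x, continuous f}.
Proof. by move=> sf Ux; have [] := sf [::] x Ux. Qed.

Lemma smooth_derivable U f x i : smooth_on U f -> U x -> derivable f x (delta_mx ord0 i).
Proof. by move=> sf Ux; have [_ /(_ i)] := sf [::] x Ux. Qed.

Section Calculus.
Variable U : set 'rV[R]_n.
Hypothesis oU : open U.

Lemma eq_smooth_upto m f g : (forall x, U x -> f x = g x) ->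
  smooth_upto m U f -> smooth_upto m U g.
Proof.
move=> fg sf s x sm Ux; have [cf df] := sf s x sm Ux.
have E : \forall z \near x, partials s f z = partials s g z.
  near=> z; apply: (eq_partials oU fg); near: z; exact: near_open.
split=> [|i]; last exact: near_eq_derivable (df i).
by move=> A; rewrite -(nbhs_singleton E) => /cf; apply: filterS2 E => z /= <-.
Unshelve. all: by end_near. Qed.

Lemma eq_smooth f g : (forall x, U x -> f x = g x) -> smooth_on U f -> smooth_on U g.
Proof.
move=> fg /smooth_uptoP sf; apply/smooth_uptoP => m; exact: eq_smooth_upto (sf m).
Qed.

Lemma smooth_upto_cst m (c : R) : smooth_upto m U (fun=> c).
Proof.
elim: m c => [|m IH] c.
  move=> s x; rewrite leqn0 => /nilP -> _ /=; split=> [|i].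
    exact: cst_continuous.
  exact: derivable_cst.
apply/smooth_uptoS; split=> [|i].
  move=> s x; rewrite leqn0 => /nilP -> _ /=; split=> [|i].
    exact: cst_continuous.
  exact: derivable_cst.
by apply: eq_smooth_upto (IH 0) => x _; rewrite /partial derive_cst.
Qed.

Lemma partialD i f g x : U x -> smooth_upto 0 U f -> smooth_upto 0 U g ->
  partial i (fun x => f x + g x) x = partial i f x + partial i g x.
Proof.
move=> Ux sf sg; have [_ /(_ i) df] := sf [::] x (leqnn _) Ux.
have [_ /(_ i) dg] := sg [::] x (leqnn _) Ux.
exact: deriveD.
Qed.

Lemma partialM i f g x : U x -> smooth_upto 0 U f -> smooth_upto 0 U g ->
  partial i (fun x => f x * g x) x = partial i f x * g x + f x * partial i g x.
Proof.
move=> Ux sf sg; have [_ /(_ i) df] := sf [::] x (leqnn _) Ux.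
have [_ /(_ i) dg] := sg [::] x (leqnn _) Ux.
by rewrite /partial (deriveM df dg) addrC [_ * g x]mulrC.
Qed.

(** The result is a product of [partial i f] with two copies of the inverse, a form to which the
    product rule and the induction hypothesis on the inverse apply directly. *)
Lemma partialV i f x : U x -> smooth_upto 0 U f -> f x != 0 ->
  partial i (fun x => (f x)^-1) x = - (partial i f x * (f x)^-1 * (f x)^-1).
Proof.
move=> Ux sf fx0; have [_ /(_ i) df] := sf [::] x (leqnn _) Ux.
by rewrite /partial (deriveV fx0 df) scaleNr [_ *: _]mulrC expr2 invfM mulrA.
Qed.

Lemma smooth_uptoD m f g : smooth_upto m U f -> smooth_upto m U g ->
  smooth_upto m U (fun x => f x + g x).
Proof.
have base u v : smooth_upto 0 U u -> smooth_upto 0 U v -> smooth_upto 0 U (fun x => u x + v x).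
  move=> su sv s x; rewrite leqn0 => /nilP -> Ux /=.
  have [cu du] := su [::] x (leqnn _) Ux; have [cv dv] := sv [::] x (leqnn _) Ux.
  by split=> [|i]; [exact: continuousD|exact: derivableD].
elim: m f g => [|m IH] f g; first exact: base.
move=> /smooth_uptoS[sf0 sf] /smooth_uptoS[sg0 sg]; apply/smooth_uptoS.
split=> [|i]; first exact: base.
by apply: eq_smooth_upto (IH _ _ (sf i) (sg i)) => x Ux; rewrite partialD.
Qed.

Lemma smooth_uptoM m f g : smooth_upto m U f -> smooth_upto m U g ->
  smooth_upto m U (fun x => f x * g x).
Proof.
have base u v : smooth_upto 0 U u -> smooth_upto 0 U v -> smooth_upto 0 U (fun x => u x * v x).
  move=> su sv s x; rewrite leqn0 => /nilP -> Ux /=.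
  have [cu du] := su [::] x (leqnn _) Ux; have [cv dv] := sv [::] x (leqnn _) Ux.
  by split=> [|i]; [exact: continuousM|exact: derivableM].
elim: m f g => [|m IH] f g; first exact: base.
move=> sf sg; have [sf0 sf'] := (smooth_uptoS _ _ _).1 sf.
have [sg0 sg'] := (smooth_uptoS _ _ _).1 sg; apply/smooth_uptoS.
split=> [|i]; first exact: base.
apply: eq_smooth_upto (smooth_uptoD (IH _ _ (sf' i) (smooth_upto_le (leqnSn m) sg))
   (IH _ _ (smooth_upto_le (leqnSn m) sf) (sg' i))) => x Ux.
by rewrite partialM.
Qed.

Lemma smooth_uptoV m f : (forall x, U x -> f x != 0) -> smooth_upto m U f ->
  smooth_upto m U (fun x => (f x)^-1).
Proof.
move=> f0.
have base : smooth_upto 0 U f -> smooth_upto 0 U (fun x => (f x)^-1).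
  move=> sf s x; rewrite leqn0 => /nilP -> Ux /=.
  have [cf df] := sf [::] x (leqnn _) Ux.
  split=> [|i]; first by apply: continuousV => //; exact: f0.
  by apply: derivableV => //; exact: f0.
elim: m => [|m IH] //.
move=> sf; have [sf0 sf'] := (smooth_uptoS _ _ _).1 sf; apply/smooth_uptoS.
split=> [|i]; first exact: base.
have sV := IH (smooth_upto_le (leqnSn m) sf).
apply: eq_smooth_upto (smooth_uptoM (@smooth_upto_cst m (-1))
  (smooth_uptoM (smooth_uptoM (sf' i) sV) sV)) => x Ux.
by rewrite partialV ?mulN1r//; exact: f0.
Qed.

Lemma smooth_cst (c : R) : smooth_on U (fun=> c).
Proof. by apply/smooth_uptoP => m; exact: smooth_upto_cst. Qed.

Lemma smoothD f g : smooth_on U f -> smooth_on U g -> smooth_on U (fun x => f x + g x).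
Proof.
by move=> /smooth_uptoP sf /smooth_uptoP sg; apply/smooth_uptoP => m; exact: smooth_uptoD.
Qed.

Lemma smoothM f g : smooth_on U f -> smooth_on U g -> smooth_on U (fun x => f x * g x).
Proof.
by move=> /smooth_uptoP sf /smooth_uptoP sg; apply/smooth_uptoP => m; exact: smooth_uptoM.
Qed.

Lemma smoothV f : (forall x, U x -> f x != 0) -> smooth_on U f ->
  smooth_on U (fun x => (f x)^-1).
Proof.
by move=> f0 /smooth_uptoP sf; apply/smooth_uptoP => m; exact: smooth_uptoV.
Qed.

Lemma smoothB f g : smooth_on U f -> smooth_on U g -> smooth_on U (fun x => f x - g x).
Proof.
move=> sf sg; apply: eq_smooth (smoothD sf (smoothM (smooth_cst (-1)) sg)) => x _.
by rewrite mulN1r.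
Qed.

Lemma smooth_sum (I : Type) (r : seq I) (F : I -> 'rV[R]_n -> R) :
  (forall k, smooth_on U (F k)) -> smooth_on U (fun x => \sum_(k <- r) F k x).
Proof.
move=> sF; elim: r => [|k r IH].
  by apply: eq_smooth (smooth_cst 0) => x _; rewrite big_nil.
by apply: eq_smooth (smoothD (sF k) IH) => x _; rewrite big_cons.
Qed.

Lemma smooth0 f : smooth_on U f -> smooth_upto 0 U f.
Proof. by move=> /smooth_uptoP. Qed.

Lemma partials_cst s (c : R) x : U x -> s != [::] -> partials s (fun=> c) x = 0.
Proof.
case/lastP: s => [//|s i] Ux _; rewrite partials_rcons.
rewrite (eq_partials (g := fun=> 0) oU _ _ Ux); last by move=> z _; rewrite /partial derive_cst.
elim: s x Ux => [//|k s IH] x Ux /=.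
rewrite /partial (@near_eq_derive _ _ _ _ (fun=> 0)) ?derive_cst//.
near=> z; apply: IH; near: z; exact: near_open.
Unshelve. all: by end_near. Qed.

Lemma partialsD s f g x : U x -> smooth_on U f -> smooth_on U g ->
  partials s (fun x => f x + g x) x = partials s f x + partials s g x.
Proof.
elim/last_ind: s f g => [//|s i IH] f g Ux sf sg.
rewrite !partials_rcons -IH//; try exact: smooth_partial.
by apply: (eq_partials oU) => // z Uz; rewrite partialD//; exact: smooth0.
Qed.

Lemma partialsZ s (c : R) f x : U x -> smooth_on U f ->
  partials s (fun x => c * f x) x = c * partials s f x.
Proof.
elim/last_ind: s f => [//|s i IH] f Ux sf.
rewrite !partials_rcons -IH//; try exact: smooth_partial.
apply: (eq_partials oU) => // z Uz; rewrite partialM//; try exact: smooth0.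
  by rewrite /partial derive_cst mul0r add0r.
exact: smooth_upto_cst.
Qed.

Lemma partialsB s f g x : U x -> smooth_on U f -> smooth_on U g ->
  partials s (fun x => f x - g x) x = partials s f x - partials s g x.
Proof.
move=> Ux sf sg; rewrite -mulN1r -partialsZ// -partialsD//.
  by apply: (eq_partials oU) => // z _; rewrite mulN1r.
by apply: smoothM => //; exact: smooth_cst.
Qed.

End Calculus.
End AxisDerivatives.

(** * Symmetry of mixed partial derivatives *)

Section MixedPartials.
Context {R : realType} {n : nat}.
Implicit Types (f g u v : 'rV[R]_n -> R) (x y z : 'rV[R]_n) (i : 'I_n) (s : seq 'I_n).

Lemma is_derive_translate f (a x v : 'rV[R]_n) : derivable f (a + x) v ->
  is_derive x v (fun y => f (a + y)) ('D_v f (a + x)).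
Proof.
move=> df; have E : (fun h : R => h^-1 *: (((fun y => f (a + y)) \o shift x) (h *: v) -
    f (a + x))) = (fun h => h^-1 *: ((f \o shift (a + x)) (h *: v) - f (a + x))).
  by apply/funext => h /=; rewrite addrCA.
by split; rewrite /derivable /derive E.
Qed.

(** The mean value theorem is applied along axis [i] to the increment [g] of [f] in direction [j],
    then along axis [j] to [partial i f]. *)
Lemma second_difference_mvt (U : set 'rV[R]_n) f x i j (h : R) :
  smooth_on U f -> 0 <= h -> (forall y, eucl_dist y x <= h + h -> U y) ->
  exists2 p, eucl_dist p x <= h + h &
    f (h *: delta_mx ord0 j + (h *: delta_mx ord0 i + x)) - f (h *: delta_mx ord0 i + x) -
    (f (h *: delta_mx ord0 j + x) - f x) = h * (h * partial j (partial i f) p).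
Proof.
move=> sf h0 hU.
have inU (r r' : R) : `|r| <= h -> `|r'| <= h ->
    eucl_dist (r *: delta_mx ord0 j + (r' *: delta_mx ord0 i + x)) x <= h + h.
  move=> rh rh'; apply: (le_trans (eucl_dist_triangle (r' *: delta_mx ord0 i + x) _ _)).
  by apply: lerD; rewrite eucl_dist_axis.
have inU1 (r : R) : `|r| <= h -> U (r *: delta_mx ord0 i + x).
  by move=> rh; have := inU 0 r; rewrite normr0 scale0r add0r => /(_ h0 rh)/hU.
set g := fun y => f (h *: delta_mx ord0 j + y) - f y.
have dg (r : R) : `|r| <= h -> is_derive (r *: delta_mx ord0 i + x) (delta_mx ord0 i) g
    (partial i f (h *: delta_mx ord0 j + (r *: delta_mx ord0 i + x)) -
     partial i f (r *: delta_mx ord0 i + x)).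
  move=> rh; apply: (@is_deriveB _ _ _ (fun y => f (h *: delta_mx ord0 j + y)) f).
    apply: is_derive_translate; apply: (smooth_derivable sf); apply: hU.
    by apply: inU => //; rewrite ger0_norm.
  by apply/derivableP; apply: (smooth_derivable sf); exact: inU1.
have [|r] := @axis_mvt _ _ g x i h.
  by move=> r; rewrite (ger0_norm h0) => /dg[].
rewrite (ger0_norm h0) => rh E.
have [|r' ] := @axis_mvt _ _ (partial i f) (r *: delta_mx ord0 i + x) j h.
  move=> r'; rewrite (ger0_norm h0) => r'h.
  apply: (smooth_derivable (smooth_partial i sf)); apply: hU; exact: inU.
rewrite (ger0_norm h0) => r'h E'.
exists (r' *: delta_mx ord0 j + (r *: delta_mx ord0 i + x)); first exact: inU.
by rewrite [LHS]E [partial i g _](@derive_val _ _ _ _ _ _ _ (dg r rh)) E'.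
Qed.

(** The second difference is symmetric in the two axes, so the two mixed partials take a common
    value at points [p] and [p'] arbitrarily close to [x]. If they differed at [x], continuity would
    keep these values apart, each being within half of the gap of its own limit. *)
Lemma partial_comm (U : set 'rV[R]_n) f x i j : open U -> smooth_on U f -> U x ->
  partial i (partial j f) x = partial j (partial i f) x.
Proof.
have apart (a b c : R) : `|a - c| < `|a - b| / 2 -> ~ `|b - c| < `|a - b| / 2.
  move=> ac bc; have := ler_distD c a b; rewrite (distrC c b).
  by move=> /le_lt_trans/(_ (ltrD ac bc)); rewrite -splitr ltxx.
move=> oU sf Ux; apply/eqP/negPn/negP => neq.
set eps := `|partial i (partial j f) x - partial j (partial i f) x| / 2.
have e0 : 0 < eps by rewrite divr_gt0// normr_gt0 subr_eq0.
have c1 : {for x, continuous (partial i (partial j f))} by have [] := sf [:: i; j] x Ux.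
have c2 : {for x, continuous (partial j (partial i f))} by have [] := sf [:: j; i] x Ux.
move/cvgrPdist_lt: c1 => /(_ _ e0) N1; move/cvgrPdist_lt: c2 => /(_ _ e0) N2.
have [r r0 rA] := nbhs_eucl_ball (filterI (near_open oU Ux) (filterI N1 N2)).
have h0 : 0 < r / 2 by rewrite divr_gt0.
have hr : r / 2 + r / 2 = r by rewrite -splitr.
have rU y : eucl_dist y x <= r / 2 + r / 2 -> U y by rewrite hr => /rA[].
have [p px E] := second_difference_mvt i j sf (ltW h0) rU.
have [p' p'x E'] := second_difference_mvt j i sf (ltW h0) rU.
have : partial j (partial i f) p = partial i (partial j f) p'.
  apply: (mulfI (lt0r_neq0 h0)); apply: (mulfI (lt0r_neq0 h0)).
  apply: (etrans (esym E)); apply: (etrans _ E').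
  have swap (a b c d : R) : a - b - (c - d) = a - c - (b - d) by ring.
  by rewrite swap; congr (f _ - _ - _); exact: addrCA.
move: px p'x; rewrite hr => /rA[_ [_ H2]] /rA[_ [H1 _]] pp'.
by rewrite pp' in H2; exact: apart H1 H2.
Qed.

Lemma partials_partial (U : set 'rV[R]_n) f s i : open U -> smooth_on U f ->
  forall x, U x -> partials s (partial i f) x = partial i (partials s f) x.
Proof.
move=> oU sf; elim: s => [//|j s IH] x Ux /=.
rewrite (partial_comm _ _ oU (smooth_partials s sf) Ux).
exact: (eq_partials oU IH [:: j]).
Qed.

Lemma partials_perm (U : set 'rV[R]_n) f s t : open U -> smooth_on U f -> perm_eq s t ->
  forall x, U x -> partials s f x = partials t f x.
Proof.
move=> oU sf; elim: s t => [|i s IH] t st x Ux.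
  by move: st; rewrite perm_sym => /perm_nilP ->.
have it : i \in t by rewrite -(perm_mem st) inE eqxx.
case/splitPr: it st => t1 t2; rewrite perm_sym -(cat1s i t2) perm_catCA cat1s perm_cons perm_sym => st.
rewrite partials_cat /= (partials_partial _ _ oU (smooth_partials t2 sf) Ux).
rewrite -partials_cat.
exact: (eq_partials oU (IH _ st) [:: i]).
Qed.

End MixedPartials.

(** * Scale-invariant derivative bounds *)

Section DerivativeBounds.
Context {R : realType} {n : nat}.
Implicit Types (f g u v : 'rV[R]_n -> R) (x y z : 'rV[R]_n) (i : 'I_n) (s : seq 'I_n).
Implicit Types (d C A rho : R).

(* The weight [d ^+ size s] makes this bound submultiplicative in [u] with a
   constant depending only on [m]; [d] will be the distance to [E]. *)
Definition deriv_bound (m : nat) x d C u := forall s, (size s <= m)%N ->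
  `|partials s u x| * d ^+ size s <= C.

Lemma deriv_bound_ge0 m x d C u : deriv_bound m x d C u -> 0 <= C.
Proof. by move=> /(_ [::] isT)/=; rewrite expr0 mulr1; apply: le_trans. Qed.

Lemma deriv_bound_at m x d C u : deriv_bound m x d C u -> `|u x| <= C.
Proof. by move=> /(_ [::] isT)/=; rewrite expr0 mulr1. Qed.

Lemma deriv_bound_le m m' x d d' C C' u : (m' <= m)%N -> 0 <= d' -> d' <= d -> C <= C' ->
  deriv_bound m x d C u -> deriv_bound m' x d' C' u.
Proof.
move=> mm d'0 dd CC bu s sm; apply: le_trans CC; apply: le_trans (bu s (leq_trans sm mm)).
by apply: ler_wpM2l => //; rewrite lerXn2r// nnegrE// (le_trans d'0).
Qed.

Lemma deriv_bound0 x d C u : deriv_bound 0 x d C u <-> `|u x| <= C.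
Proof.
split=> [|uC s]; first exact: deriv_bound_at.
by rewrite leqn0 => /nilP -> /=; rewrite expr0 mulr1.
Qed.

Lemma deriv_boundS m x d C u : 0 < d -> deriv_bound m.+1 x d C u <->
  `|u x| <= C /\ forall i, deriv_bound m x d (C / d) (partial i u).
Proof.
move=> d0; split=> [bu|[uC bu] s].
  split=> [|i s sm]; first exact: deriv_bound_at bu.
  rewrite ler_pdivlMr// -mulrA -exprSr -partials_rcons.
  by have := bu (rcons s i); rewrite size_rcons => /(_ sm).
case/lastP: s => [|s i]; first by rewrite /= expr0 mulr1.
rewrite size_rcons ltnS partials_rcons exprSr mulrA -ler_pdivlMr//; exact: bu.
Qed.

Variable U : set 'rV[R]_n.
Hypothesis oU : open U.

Lemma eq_deriv_bound m x d C u v : U x -> (forall z, U z -> u z = v z) ->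
  deriv_bound m x d C u -> deriv_bound m x d C v.
Proof. by move=> Ux uv bu s sm; rewrite -(eq_partials oU uv)//; exact: bu. Qed.

Lemma deriv_boundD m x d C C' u v : U x -> 0 <= d -> smooth_on U u -> smooth_on U v ->
  deriv_bound m x d C u -> deriv_bound m x d C' v ->
  deriv_bound m x d (C + C') (fun z => u z + v z).
Proof.
move=> Ux d0 su sv bu bv s sm; rewrite (partialsD oU s Ux su sv).
apply: le_trans (lerD (bu s sm) (bv s sm)); rewrite -mulrDl.
by apply: ler_wpM2r; [exact: exprn_ge0|exact: ler_normD].
Qed.

Lemma deriv_boundZ m x d C c u : U x -> 0 <= d -> smooth_on U u ->
  deriv_bound m x d C u -> deriv_bound m x d (`|c| * C) (fun z => c * u z).
Proof.
move=> Ux d0 su bu s sm; rewrite (partialsZ oU s _ Ux su) normrM -mulrA.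
by apply: ler_wpM2l => //; exact: bu.
Qed.

Lemma deriv_boundB m x d C C' u v : U x -> 0 <= d -> smooth_on U u -> smooth_on U v ->
  deriv_bound m x d C u -> deriv_bound m x d C' v ->
  deriv_bound m x d (C + C') (fun z => u z - v z).
Proof.
move=> Ux d0 su sv bu bv s sm; rewrite (partialsB oU s Ux su sv).
apply: le_trans (lerD (bu s sm) (bv s sm)); rewrite -mulrDl.
by apply: ler_wpM2r; [exact: exprn_ge0|exact: ler_normB].
Qed.

(** Each differentiation turns a product into two products, hence the factor [2 ^+ m]. *)
Lemma deriv_boundM m x d C C' u v : U x -> 0 < d -> smooth_on U u -> smooth_on U v ->
  deriv_bound m x d C u -> deriv_bound m x d C' v ->
  deriv_bound m x d (2 ^+ m * (C * C')) (fun z => u z * v z).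
Proof.
move=> Ux d0; elim: m u v C C' => [|m IH] u v C C' su sv bu bv.
  apply/deriv_bound0; rewrite normrM expr0 mul1r.
  by apply: ler_pM => //; [exact: deriv_bound_at bu|exact: deriv_bound_at bv].
have [C0 C'0] := (deriv_bound_ge0 bu, deriv_bound_ge0 bv).
apply/(deriv_boundS _ _ _ _ d0); split=> [|i].
  rewrite normrM; apply: (@le_trans _ _ (C * C')).
    by apply: ler_pM => //; [exact: deriv_bound_at bu|exact: deriv_bound_at bv].
  by apply: ler_peMl; [exact: mulr_ge0|apply: exprn_ege1; rewrite ler1n].
have [_ /(_ i) bu'] := (deriv_boundS _ _ _ _ d0).1 bu.
have [_ /(_ i) bv'] := (deriv_boundS _ _ _ _ d0).1 bv.
have lw C1 w : deriv_bound m.+1 x d C1 w -> deriv_bound m x d C1 w.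
  by apply: deriv_bound_le => //; exact: ltW.
have su' := smooth_partial i su; have sv' := smooth_partial i sv.
have := deriv_boundD Ux (ltW d0) (smoothM oU su' sv) (smoothM oU su sv')
  (IH _ _ _ _ su' sv bu' (lw _ _ bv)) (IH _ _ _ _ su sv' (lw _ _ bu) bv').
rewrite (_ : _ + _ = 2 ^+ m.+1 * (C * C') / d); last first.
  by rewrite exprS; field; rewrite lt0r_neq0.
apply: eq_deriv_bound => // z Uz; rewrite (partialM _ Uz)//; exact: smooth0.
Qed.

(** Both bounds are relative to the value [u x], so [K] is chosen before [u], [x] and [d]. This
    uniformity is what makes division by [h] possible near [E]. *)
Lemma deriv_boundV m C : 1 <= C -> exists2 K, 1 <= K & forall x d u,
  U x -> 0 < d -> smooth_on U u -> (forall z, U z -> 0 < u z) ->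
  deriv_bound m x d (C * u x) u -> deriv_bound m x d (K / u x) (fun z => (u z)^-1).
Proof.
move=> C1; elim: m => [|m [K K1 IH]].
  exists 1 => // x d u Ux d0 su u0 bu; apply/deriv_bound0.
  by rewrite mul1r ger0_norm// invr_ge0 ltW// u0.
have C0 : 0 <= C by exact: le_trans C1.
have K0 : 0 <= K by exact: le_trans K1.
have P1 : 0 <= 2 ^+ m * (2 ^+ m * (C * K) * K) :> R.
  by rewrite !mulr_ge0// exprn_ge0.
exists (1 + 2 ^+ m * (2 ^+ m * (C * K) * K)); first by rewrite lerDl.
move=> x d u Ux d0 su u0 bu; have ux0 := u0 x Ux.
have un0 z : U z -> u z != 0 by move=> /u0/lt0r_neq0.
apply/(deriv_boundS _ _ _ _ d0); split=> [|i].
  rewrite ger0_norm ?invr_ge0 ?(ltW ux0)// -[leLHS]mul1r ler_pM2r ?invr_gt0//.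
  by rewrite lerDl.
have [_ /(_ i) bu'] := (deriv_boundS _ _ _ _ d0).1 bu.
have bV : deriv_bound m x d (K / u x) (fun z => (u z)^-1).
  by apply: IH => //; apply: deriv_bound_le bu => //; exact: ltW.
have su' := smooth_partial i su; have sV := smoothV oU un0 su.
have sM := smoothM oU su' sV.
have := deriv_boundZ (-1) Ux (ltW d0) (smoothM oU sM sV)
  (deriv_boundM Ux d0 sM sV (deriv_boundM Ux d0 su' sV bu' bV) bV).
rewrite normrN1 mul1r => H.
have {}H := @eq_deriv_bound _ _ _ _ _ (partial i (fun z => (u z)^-1)) Ux _ H.
apply: (@deriv_bound_le _ _ _ _ _ _ _ _ _ _ _ _ (H _)) => //; first exact: ltW.
  rewrite (_ : 2 ^+ m * _ = (2 ^+ m * (2 ^+ m * (C * K) * K)) / u x / d); last first.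
    by field; rewrite !lt0r_neq0.
  by rewrite !ler_pM2r ?invr_gt0// lerDr.
by move=> z Uz; rewrite (partialV _ Uz) ?un0 ?mulN1r//; exact: smooth0.
Qed.

End DerivativeBounds.

(** * Propagation of derivative bounds across a ball *)

Section BallEstimates.
Context {R : realType} {n : nat}.
Implicit Types (f g u v : 'rV[R]_n -> R) (x y z e : 'rV[R]_n) (i : 'I_n) (s : seq 'I_n).
Implicit Types (M A rho : R) (U : set 'rV[R]_n).

(* The two points are joined by a path parallel to the axes; all of its points
   are no farther from [e] than [z]. *)
Lemma ball_mvt v e z rho M : eucl_dist z e <= rho -> 0 <= M ->
  (forall y i, eucl_dist y e <= rho -> derivable v y (delta_mx ord0 i) /\ `|partial i v y| <= M) ->
  `|v z - v e| <= n%:R * (M * eucl_dist z e).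
Proof.
move=> ze M0 dv.
pose w (k : nat) : 'rV[R]_n := \row_(i < n) (if (i < k)%N then z ord0 i else e ord0 i).
suff H k : (k <= n)%N -> `|v (w k) - v e| <= k%:R * (M * eucl_dist z e).
  have := H n (leqnn n); rewrite (_ : w n = z)//.
  by apply/rowP => i; rewrite mxE ltn_ord.
elim: k => [_|k IH kn].
  rewrite (_ : w 0 = e) ?subrr ?normr0 ?mul0r//.
  by apply/rowP => i; rewrite mxE.
pose i := Ordinal kn; pose t := z ord0 i - e ord0 i.
have wS : w k.+1 = t *: delta_mx ord0 i + w k.
  apply/rowP => j; rewrite !mxE eqxx /= ltnS leq_eqVlt.
  have [-> | ji] := eqVneq j i; first by rewrite /= eqxx ltnn mulr1 subrK.
  by rewrite mulr0 add0r (_ : nat_of_ord j == k = false)//; apply/negbTE.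
have [|r rt E] := @axis_mvt _ _ v (w k) i t.
  move=> r rt; have [] // := dv (r *: delta_mx ord0 i + w k) i.
  apply: le_trans ze; apply: eucl_norm_le => j; rewrite !mxE eqxx /=.
  have [-> | ji] := eqVneq j i; first by rewrite ltnn mulr1 addrK.
  by rewrite mulr0 add0r; case: ifP => _; rewrite ?subrr ?normr0.
have -> : v (w k.+1) - v e = (v (w k.+1) - v (w k)) + (v (w k) - v e) by rewrite addrA subrK.
apply: le_trans (ler_normD _ _) _; rewrite -natr1 addrC mulrDl mul1r; apply: lerD.
  exact/IH/ltnW.
rewrite wS E normrM mulrC; apply: ler_pM => //.
  have [] // := dv (r *: delta_mx ord0 i + w k) i.
  apply: le_trans ze; apply: eucl_norm_le => j; rewrite !mxE eqxx /=.
  have [-> | ji] := eqVneq j i; first by rewrite ltnn mulr1 addrK.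
  by rewrite mulr0 add0r; case: ifP => _; rewrite ?subrr ?normr0.
by have := coord_le_eucl_norm (z - e) i; rewrite !mxE.
Qed.

(** A substitute for Taylor's formula: descending from order [p.+1], a bound on one order over the
    whole ball and a bound on the previous order at the centre bound the previous order over the
    ball. Each descent costs a factor [1 + n], with [n] from the axis-parallel path. *)
Lemma deriv_bound_transfer p U u e x rho A : smooth_on U u -> 0 < rho ->
  (forall z, eucl_dist z e <= rho -> U z) -> eucl_dist x e <= rho ->
  deriv_bound p e rho A u ->
  (forall s z, size s = p.+1 -> eucl_dist z e <= rho ->
     `|partials s u z| * rho ^+ p.+1 <= A) ->
  deriv_bound p.+1 x rho ((1 + n%:R) ^+ p.+1 * A) u.
Proof.
move=> su rho0 ballU xe be top.
have A0 := deriv_bound_ge0 be.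
have n0 : 0 <= n%:R :> R by exact: ler0n.
(* Here [k] is the number of orders by which [s] falls short of the top order [p.+1]. *)
suff H k s z : (size s + k = p.+1)%N -> eucl_dist z e <= rho ->
    `|partials s u z| * rho ^+ size s <= (1 + n%:R) ^+ k * A.
  move=> s sp; apply: (@le_trans _ _ ((1 + n%:R) ^+ (p.+1 - size s) * A)).
    by apply: H => //; rewrite subnKC.
  apply: ler_wpM2r => //; apply: ler_weXn2l; first by rewrite lerDl.
  exact: leq_subr.
elim: k s z => [|k IH] s z; first by rewrite addn0 expr0 mul1r => sp; rewrite sp; exact: top.
move=> sk ze; have [r0 rs0] : 0 <= rho /\ 0 < rho ^+ size s by rewrite ltW// exprn_gt0.
pose M := (1 + n%:R) ^+ k * A / rho ^+ (size s).+1.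
have M0 : 0 <= M by rewrite !mulr_ge0// ?invr_ge0 exprn_ge0// addr_ge0.
have mv : `|partials s u z - partials s u e| <= n%:R * (M * eucl_dist z e).
  apply: ball_mvt ze M0 _ => y i ye; split.
    exact: (smooth_derivable (smooth_partials s su) (ballU _ ye)).
  rewrite ler_pdivlMr ?exprn_gt0//.
  by have := IH (i :: s) y; rewrite /= => -> //; rewrite addSnnS.
have es : `|partials s u e| * rho ^+ size s <= A.
  by apply: be; rewrite -ltnS -sk -addSnnS leq_addr.
rewrite -[partials s u z](subrK (partials s u e)).
apply: le_trans (ler_wpM2r (ltW rs0) (ler_normD _ _)) _; rewrite mulrDl.
have P1 : 1 <= (1 + n%:R : R) ^+ k by apply: exprn_ege1; rewrite lerDl.
apply: (@le_trans _ _ (n%:R * ((1 + n%:R) ^+ k * A) + (1 + n%:R) ^+ k * A)); last first.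
  by rewrite exprS -mulrA mulrDl mul1r addrC.
apply: lerD; last by apply: le_trans es _; exact: ler_peMl.
apply: le_trans (ler_wpM2r (ltW rs0) mv) _.
rewrite -mulrA; apply: ler_wpM2l => //; rewrite -mulrA /M exprS.
have -> : (1 + n%:R) ^+ k * A / (rho * rho ^+ size s) * (eucl_dist z e * rho ^+ size s) =
  (1 + n%:R) ^+ k * A * (eucl_dist z e / rho) by field; rewrite !lt0r_neq0.
apply: ler_piMr; first by rewrite mulr_ge0// (le_trans _ P1).
by rewrite ler_pdivrMr// mul1r.
Qed.

End BallEstimates.

(** * Taylor polynomials *)

Section MultiIndices.
Context {n : nat}.
Implicit Types (i k : 'I_n) (j : multiindex n) (s : seq 'I_n).

(** Differentiating a Taylor polynomial along the axes of [s] shifts the index of the jet in this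
    way. In particular [madd mzero s] is the multi-index of the sequence [s]. *)
Definition madd j s : multiindex n := [ffun i => (j i + count_mem i s)%N].

(** This is literally the sequence in [Dmulti], so [Dmulti j] and [partials (mseq j)] are
    convertible. *)
Definition mseq j : seq 'I_n := flatten [seq nseq (j i) i | i <- enum 'I_n].

Definition mzero : multiindex n := [ffun=> 0%N].

Lemma count_mseq j i : count_mem i (mseq j) = j i.
Proof.
rewrite /mseq count_flatten -map_comp sumnE big_map big_enum /= (bigD1 i)//=.
rewrite big1 ?addn0 => [|k /negPf ki].
  by rewrite count_nseq /= eqxx mul1n.
by rewrite count_nseq /= ki.
Qed.

Lemma size_mseq j : size (mseq j) = mdegree j.
Proof.
rewrite /mseq size_flatten /shape -map_comp sumnE big_map big_enum /=.
by apply: eq_bigr => i _; rewrite /= size_nseq.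
Qed.

Lemma madd_mseq j : madd mzero (mseq j) = j.
Proof. by apply/ffunP => i; rewrite !ffunE count_mseq. Qed.

Lemma perm_mseq s : perm_eq s (mseq (madd mzero s)).
Proof. by apply/allP => i _; rewrite /= count_mseq !ffunE. Qed.

Lemma mdegree_madd j s : mdegree (madd j s) = (mdegree j + size s)%N.
Proof.
have -> : size s = (\sum_(i < n) count_mem i s)%N.
  by rewrite (perm_size (perm_mseq s)) size_mseq; apply: eq_bigr => i _; rewrite !ffunE.
by rewrite -big_split /=; apply: eq_bigr => i _; rewrite ffunE.
Qed.

Lemma mdegree_mzero : mdegree mzero = 0%N.
Proof. by apply: big1 => i _; rewrite ffunE. Qed.

Lemma madd_rcons j s k : madd (madd j s) [:: k] = madd j (rcons s k).
Proof. by apply/ffunP => i; rewrite !ffunE -cats1 count_cat addnA. Qed.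

Lemma madd1_inj k : injective (madd^~ [:: k]).
Proof.
by move=> j j' /ffunP E; apply/ffunP => i; have := E i; rewrite !ffunE => /addIn.
Qed.

Lemma mfactorial_madd1 j k : mfactorial (madd j [:: k]) = ((j k).+1 * mfactorial j)%N.
Proof.
rewrite /mfactorial (bigD1 k)//= [in RHS](bigD1 k)//= mulnA !ffunE /= eqxx addn1 factS.
congr (_ * _)%N; apply: eq_bigr => i /negPf ik.
by rewrite !ffunE /= eq_sym ik !addn0.
Qed.

Lemma mfactorial_mzero : mfactorial mzero = 1%N.
Proof. by apply: big1 => i _; rewrite ffunE. Qed.

Lemma finite_mindices {R : realType} (a : R) : finite_set (@mindices n R a).
Proof.
pose N := Num.truncn a.
apply: (@sub_finite_set _ _ ((fun h : {ffun 'I_n -> 'I_N.+1} => [ffun i => nat_of_ord (h i)] : multiindex n) @` setT)); last first.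
  by apply: finite_image; exact: finite_finset.
move=> j /= ja; have jN i : (j i < N.+1)%N.
  rewrite ltnS; apply: leq_trans (_ : mdegree j <= _)%N.
    by rewrite /mdegree (bigD1 i)//= leq_addr.
  by rewrite truncn_ge_nat// (le_trans _ ja).
exists [ffun i => Ordinal (jN i)] => //.
by apply/ffunP => i; rewrite !ffunE.
Qed.

End MultiIndices.

Section TaylorPolynomials.
Context {R : realType} {n : nat}.
Implicit Types (x y z : 'rV[R]_n) (i k : 'I_n) (j : multiindex n) (s : seq 'I_n) (a : R).
Implicit Types (f : multiindex n -> 'rV[R]_n -> R).

Lemma is_derive_coord x i k (c : R) :
  is_derive x (delta_mx ord0 k) (fun z : 'rV[R]_n => z ord0 i - c) (i == k)%:R.
Proof.
have dc : is_derive x (delta_mx ord0 k) (fun z : 'rV[R]_n => z ord0 i) (i == k)%:R.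
  split; first by have /derivable_mxP := @derivable_id _ _ x (delta_mx ord0 k); apply.
  have := derive_mx (@derivable_id _ _ x (delta_mx ord0 k)).
  by move=> /matrixP/(_ ord0 i); rewrite derive_id !mxE eqxx /= => <-.
have := is_deriveB dc (is_derive_cst c x (delta_mx ord0 k)); rewrite subr0.
exact.
Qed.

Lemma smooth_coord (U : set 'rV[R]_n) i (c : R) : open U ->
  smooth_on U (fun z => z ord0 i - c).
Proof.
move=> oU; apply/smooth_uptoP => m.
have base : smooth_upto 0 U (fun z => z ord0 i - c).
  move=> s x; rewrite leqn0 => /nilP -> Ux /=; split=> [|k].
    by apply: continuousB; [exact: coord_continuous|exact: cst_continuous].
  by have [] := is_derive_coord x i k c.
case: m => // m; apply/smooth_uptoS; split=> // k.
apply: (eq_smooth_upto oU _ (@smooth_upto_cst _ _ _ oU m (i == k)%:R)) => x _.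
by rewrite /partial; have [_ ->] := is_derive_coord x i k c.
Qed.

Lemma smoothX (U : set 'rV[R]_n) (u : 'rV[R]_n -> R) (m : nat) : open U ->
  smooth_on U u -> smooth_on U (fun z => u z ^+ m).
Proof.
move=> oU su; elim: m => [|m IH].
  exact: (eq_smooth oU _ (smooth_cst oU 1)).
by apply: (eq_smooth oU _ (smoothM oU su IH)) => x _; rewrite exprS.
Qed.

Lemma smooth_prod (U : set 'rV[R]_n) (I : Type) (r : seq I) (P : pred I)
    (F : I -> 'rV[R]_n -> R) : open U ->
  (forall l, smooth_on U (F l)) -> smooth_on U (fun x => \prod_(l <- r | P l) F l x).
Proof.
move=> oU sF; elim: r => [|l r IH].
  by apply: (eq_smooth oU _ (smooth_cst oU 1)) => x _; rewrite big_nil.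
have [Pl|/negPf Pl] := boolP (P l).
  by apply: (eq_smooth oU _ (smoothM oU (sF l) IH)) => x _; rewrite big_cons Pl.
by apply: (eq_smooth oU _ IH) => x _; rewrite big_cons Pl.
Qed.

Lemma smooth_mpower (U : set 'rV[R]_n) y j : open U -> smooth_on U (fun x => mpower (x - y) j).
Proof.
move=> oU; apply: smooth_prod => // i; apply: smoothX => //.
by apply: (eq_smooth oU _ (smooth_coord i (y ord0 i) oU)) => x _; rewrite !mxE.
Qed.

Lemma partial_mpower y j k x : partial k (fun x => mpower (x - y) j) x =
  (j k)%:R * (x ord0 k - y ord0 k) ^+ (j k).-1 * \prod_(i < n | i != k) (x - y) ord0 i ^+ j i.
Proof.
(* [G] collects the factors that do not involve coordinate [k]; it is constant along that axis. *)
pose G (x : 'rV[R]_n) := \prod_(i < n | i != k) (x - y) ord0 i ^+ j i.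
have dG : is_derive x (delta_mx ord0 k) G 0.
  have E (h : R) : G (h *: delta_mx ord0 k + x) = G x.
    apply: eq_bigr => i /negPf ik.
    by rewrite !mxE ik andbF mulr0 add0r.
  split; first apply/derivable1P.
    by rewrite (_ : (fun h => _) = cst (G x)); [exact: derivable_cst|exact/funext].
  rewrite /derive (_ : (fun h : R => _) = cst 0); first exact: lim_cst.
  by apply/funext => h /=; rewrite E subrr scaler0.
have dX := is_deriveX (j k) (is_derive_coord x k k (y ord0 k)).
have /@derive_val := is_deriveM dX dG.
rewrite /partial => D.
transitivity ('D_(delta_mx ord0 k) ((fun z : 'rV[R]_n => z ord0 k - y ord0 k) ^+ j k * G) x).
  congr ('D_ _ _ _); apply/funext => z; rewrite exprfctE /mpower (bigD1 k)//=.
  by rewrite mxE [in LHS]mxE.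
rewrite D scaler0 add0r eqxx -[_ *: 1]/(_ * 1) mulr1 -[_ *: _]/(G x * _) mulrC.
by [].
Qed.

Lemma partial_mpower_madd1 y j k x : partial k (fun x => mpower (x - y) (madd j [:: k])) x =
  (j k).+1%:R * mpower (x - y) j.
Proof.
rewrite partial_mpower !ffunE /= eqxx addn1 -mulrA; congr (_ * _).
rewrite /mpower [in RHS](bigD1 k)//= [in RHS]mxE [in RHS]mxE.
congr (_ * _); apply: eq_bigr => i /negPf ik.
by rewrite !ffunE /= eq_sym ik !addn0.
Qed.

Lemma partial_mpower_eq0 y j k x : j k = 0%N -> partial k (fun x => mpower (x - y) j) x = 0.
Proof. by move=> jk; rewrite partial_mpower jk !mul0r. Qed.

Lemma taylorE a f y x : taylor a f y x =
  \sum_(j <- finmap.enum_fset (fset_set (@mindices n R a))) (mfactorial j)%:R^-1 * f j y * mpower (x - y) j.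
Proof. by rewrite /taylor fsbig_finite//; exact: finite_mindices. Qed.

Lemma smooth_taylor (U : set 'rV[R]_n) a f y : open U -> smooth_on U (taylor a f y).
Proof.
move=> oU; apply: (eq_smooth oU (fun x _ => esym (taylorE a f y x))).
apply: smooth_sum => // j; apply: smoothM => //; last exact: smooth_mpower.
exact: smooth_cst.
Qed.

Lemma partial_sum (I : Type) (r : seq I) (F : I -> 'rV[R]_n -> R) k x :
  (forall l, smooth_on setT (F l)) ->
  partial k (fun x => \sum_(l <- r) F l x) x = \sum_(l <- r) partial k (F l) x.
Proof.
move=> sF; elim: r => [|l r IH].
  rewrite big_nil (_ : (fun x => _) = cst 0) /partial ?derive_cst//.
  by apply/funext => z; rewrite big_nil.
rewrite big_cons -IH -(@partialD _ _ setT)//; last 2 first.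
  - by apply: smooth0.
  - apply: smooth0; apply: smooth_sum => //; exact: openT.
by congr (partial k _ x); apply/funext => z; rewrite big_cons.
Qed.

(** Monomials without the variable [k] disappear. The others are indexed injectively by [madd j
    [:: k]] with [j] of degree at most [a - 1], and the exponent produced by the derivative cancels
    against the factorial. *)
Lemma partial_taylor a f y k :
  partial k (taylor a f y) = taylor (a - 1) (fun j => f (madd j [:: k])) y.
Proof.
apply/funext => x; have oT : open (@setT 'rV[R]_n) by exact: openT.
rewrite (_ : taylor a f y = fun x => \sum_(j <- finmap.enum_fset (fset_set (mindices a)))
   (mfactorial j)%:R^-1 * f j y * mpower (x - y) j); last first.
  by apply/funext => z; rewrite taylorE.
rewrite partial_sum; last first.
  by move=> j; apply: smoothM => //; [exact: smooth_cst|exact: smooth_mpower].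
have E j : partial k (fun x => (mfactorial j)%:R^-1 * f j y * mpower (x - y) j) x =
    (mfactorial j)%:R^-1 * f j y * partial k (fun x => mpower (x - y) j) x.
  rewrite (@partialM _ _ setT)//.
  - by rewrite /partial derive_cst mul0r add0r.
  - by apply: smooth0; exact: smooth_cst.
  - by apply: smooth0; exact: smooth_mpower.
rewrite (eq_bigr _ (fun j _ => E j)) -fsbig_finite; last exact: finite_mindices.
rewrite /taylor -(@fsbig_widen _ _ _ _ ((madd^~ [:: k]) @` mindices (a - 1))); last 2 first.
- by move=> _ [j /= ja <-]; rewrite /mindices /= mdegree_madd natrD -lerBrDr.
- move=> j [/= ja jn] /=; apply/eqP; rewrite mulf_eq0; apply/orP; right.
  apply/eqP; apply: partial_mpower_eq0; apply/eqP/negPn/negP => jk; apply: jn.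
  have E' : madd [ffun i => (j i - (i == k))%N] [:: k] = j.
    apply/ffunP => i; rewrite !ffunE /= addn0 eq_sym subnK//.
    by case: eqP => //= <-; rewrite lt0n.
  by exists [ffun i => (j i - (i == k))%N] => //; rewrite /mindices /= lerBrDr natr1 -[_.+1]addn1 -(mdegree_madd _ [:: k]) E'.
rewrite fsbig_image; last by move=> j j' _ _; exact: madd1_inj.
apply: eq_fsbigr => j _; rewrite partial_mpower_madd1 mfactorial_madd1 natrM invfM.
have : (j k).+1%:R != 0 :> R by rewrite pnatr_eq0.
by move: (j k).+1%:R (mfactorial j)%:R^-1 (f _ _) (mpower _ _) => b c d e b0; field.
Qed.

Lemma partials_taylor a f y s : partials s (taylor a f y) =
  taylor (a - (size s)%:R) (fun j => f (madd j s)) y.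
Proof.
elim/last_ind: s a f => [|s k IH] a f.
  rewrite /= subr0; congr (taylor a _ y); apply/funext => j.
  by congr f; apply/ffunP => i; rewrite ffunE addn0.
rewrite partials_rcons partial_taylor IH size_rcons; congr (taylor _ _ y).
  by rewrite -natr1 opprD addrA addrAC.
by apply/funext => j; rewrite madd_rcons.
Qed.

Lemma taylor_lt0 a f y x : a < 0 -> taylor a f y x = 0.
Proof.
move=> a0; rewrite /taylor fsbig1// => j; rewrite /mindices /= => ja.
by have := le_lt_trans ja a0; rewrite ltrn0.
Qed.

Lemma taylor_diag a f y : 0 <= a -> taylor a f y y = f mzero y.
Proof.
move=> a0; rewrite /taylor -(@fsbig_widen _ _ _ _ [set mzero]).
- rewrite fsbig_set1 mfactorial_mzero invr1 mul1r /mpower big1 ?mulr1// => i _.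
  by rewrite ffunE expr0.
- by move=> _ /= ->; rewrite /mindices /= mdegree_mzero.
- move=> j [/= _ j0]; rewrite subrr.
  have [i ji] : exists i, j i != 0%N.
    apply/existsP; apply: contra_notT j0 => /existsPn j0.
    by apply/ffunP => i; rewrite ffunE; apply/eqP; have := j0 i; rewrite negbK.
  by rewrite /mpower (bigD1 i)//= mxE expr0n (negPf ji) mul0r mulr0.
Qed.

Lemma partials_taylor_diag a f y s : (size s)%:R <= a ->
  partials s (taylor a f y) y = f (madd mzero s) y.
Proof. by move=> sa; rewrite partials_taylor taylor_diag ?subr_ge0. Qed.

Lemma partials_taylor_eq0 a f y s x : a < (size s)%:R -> partials s (taylor a f y) x = 0.
Proof. by move=> sa; rewrite partials_taylor taylor_lt0// subr_lt0. Qed.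

Lemma partials_Dmulti (U : set 'rV[R]_n) u s x : open U -> smooth_on U u -> U x ->
  partials s u x = Dmulti (madd mzero s) u x.
Proof. by move=> oU su; exact: partials_perm (perm_mseq s) _. Qed.

End TaylorPolynomials.

(** * Powers of the distance *)

Section DistancePowers.
Context {R : realType} {n : nat}.
Implicit Types (x y z : 'rV[R]_n) (i k : 'I_n) (p d : R) (u : 'rV[R]_n -> R).

Lemma is_derive_of_line u x (v : 'rV[R]_n) (b : R) :
  is_derive (0 : R) 1 (fun t => u (t *: v + x)) b -> is_derive x v u b.
Proof.
move=> [dl <-]; have du : derivable u x v by apply/derivable1P.
have : derivable u ((0 : R) *: v + x) v by rewrite scale0r add0r.
by move=> /is_derive_line[_ ->]; rewrite scale0r add0r; split.
Qed.

Lemma is_derive_powR_comp u x (v : 'rV[R]_n) (b c : R) : 0 < u x ->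
  is_derive x v u b -> is_derive x v (fun z => u z `^ c) (c * u x `^ (c - 1) * b).
Proof.
move=> u0 [du <-]; apply: is_derive_of_line.
have dl : is_derive (0 : R) 1 (fun t => u (t *: v + x)) ('D_v u x).
  have : derivable u ((0 : R) *: v + x) v by rewrite scale0r add0r.
  by move=> /is_derive_line; rewrite scale0r add0r.
have dp : is_derive ((fun t => u (t *: v + x)) (0 : R)) 1 (@powR R ^~ c) (c * u x `^ (c - 1)).
  by rewrite scale0r add0r; exact: is_derive1_powR.
exact: (@is_derive1_comp _ (@powR R ^~ c) (fun t => u (t *: v + x))).
Qed.

(** Expressing the power through the squared distance, a polynomial, avoids differentiating the
    square root. *)
Lemma dist_powE p x y :
  eucl_dist x y `^ p = (\sum_(i < n) (x ord0 i - y ord0 i) ^+ 2) `^ (2^-1 * p).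
Proof.
rewrite powRrM powR12_sqrt ?sumr_ge0// => [|i _]; last exact: sqr_ge0.
by congr (_ `^ p); congr Num.sqrt; apply: eq_bigr => i _; rewrite !mxE.
Qed.

Lemma is_derive_dist_pow p x y k : x != y ->
  is_derive x (delta_mx ord0 k) (fun z => eucl_dist z y `^ p)
    (p * ((x ord0 k - y ord0 k) * eucl_dist x y `^ (p - 2))).
Proof.
move=> xy; pose sq := \sum_(i < n) (fun z : 'rV[R]_n => z ord0 i - y ord0 i) ^+ 2.
have sqE z : sq z = \sum_(i < n) (z ord0 i - y ord0 i) ^+ 2.
  by rewrite /sq fct_sumE; apply: eq_bigr => i _; rewrite exprfctE.
have sq0 : 0 < sq x.
  have : 0 < eucl_dist x y by rewrite eucl_dist_gt0.
  by rewrite /eucl_dist /eucl_norm sqrtr_gt0 sqE; under eq_bigr do rewrite !mxE.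
have dsq : is_derive x (delta_mx ord0 k) sq (2 * (x ord0 k - y ord0 k)).
  have := is_derive_sum (fun i => is_deriveX 2 (is_derive_coord x i k (y ord0 i))).
  rewrite -/sq; congr (is_derive _ _ _ _); rewrite (bigD1 k)//= big1 => [|i /negPf ->].
    by rewrite eqxx expr1 addr0 -[_ *: 1]/(_ * 1) mulr1.
  by rewrite scaler0.
have := is_derive_powR_comp (2^-1 * p) sq0 dsq.
rewrite (_ : (fun z => sq z `^ _) = (fun z => eucl_dist z y `^ p)); last first.
  by apply/funext => z; rewrite dist_powE sqE.
congr (is_derive _ _ _ _); rewrite dist_powE -sqE.
have -> : 2^-1 * (p - 2) = 2^-1 * p - 1 by field.
by move: (sq x `^ _) => c; field.
Qed.

Lemma dist_pow_continuous p x y : x != y -> {for x, continuous (fun z => eucl_dist z y `^ p)}.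
Proof.
move=> xy; apply: (@continuous_comp _ _ _ (fun z => eucl_dist z y) (@powR R ^~ p)).
  exact: eucl_dist_continuousl.
apply/differentiable_continuous/derivable1_diffP.
by have [] := is_derive1_powR p (_ : 0 < eucl_dist x y); rewrite // eucl_dist_gt0.
Qed.

Variable U : set 'rV[R]_n.
Hypothesis oU : open U.

Let neqU x y : U x -> ~ U y -> x != y.
Proof. by move=> Ux Uy; apply: contra_notN Uy => /eqP <-. Qed.

Lemma partial_dist_pow p x y k : U x -> ~ U y ->
  partial k (fun z => eucl_dist z y `^ p) x =
  p * ((x ord0 k - y ord0 k) * eucl_dist x y `^ (p - 2)).
Proof.
by move=> Ux Uy; rewrite /partial; have [_ ->] := is_derive_dist_pow p k (neqU Ux Uy).
Qed.

Lemma smooth_dist_pow p y : ~ U y -> smooth_on U (fun z => eucl_dist z y `^ p).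
Proof.
move=> Uy; apply/smooth_uptoP => m; elim: m p => [|m IH] p.
  move=> s x; rewrite leqn0 => /nilP -> Ux /=; split=> [|k].
    by apply: dist_pow_continuous; exact: neqU.
  by have [] := is_derive_dist_pow p k (neqU Ux Uy).
apply/smooth_uptoS; split=> [|k].
  move=> s x; rewrite leqn0 => /nilP -> Ux /=; split=> [|k].
    by apply: dist_pow_continuous; exact: neqU.
  by have [] := is_derive_dist_pow p k (neqU Ux Uy).
apply: (eq_smooth_upto oU (fun x Ux => esym (partial_dist_pow p k Ux Uy))).
apply: smooth_uptoM => //; first exact: smooth_upto_cst.
apply: smooth_uptoM => //.
by move: m {IH}; apply/smooth_uptoP; exact: smooth_coord.
Qed.

Lemma deriv_bound_cst m x d (c : R) : U x -> deriv_bound m x d `|c| (fun=> c).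
Proof.
move=> Ux s sm; have [->|s0] := eqVneq s [::]; first by rewrite /= expr0 mulr1.
by rewrite (partials_cst oU) // normr0 mul0r.
Qed.

Lemma deriv_bound_coord m x y k d : U x -> 0 < d -> d <= eucl_dist x y ->
  deriv_bound m x d (eucl_dist x y) (fun z => z ord0 k - y ord0 k).
Proof.
move=> Ux d0 dxy.
have b0 : `|x ord0 k - y ord0 k| <= eucl_dist x y.
  by have := coord_le_eucl_norm (x - y) k; rewrite !mxE.
case: m => [|m]; first exact/deriv_bound0.
apply/deriv_boundS => //; split=> // i.
apply: (@eq_deriv_bound _ _ U oU m x d _ (fun=> (k == i)%:R)) => //.
  by move=> z _; rewrite /partial; have [_ ->] := is_derive_coord z k i (y ord0 k).
have := @deriv_bound_cst m x d (k == i)%:R Ux; apply: deriv_bound_le => //; first exact: ltW.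
rewrite normr_nat; apply: (@le_trans _ _ 1); first by rewrite lern1 leq_b1.
by rewrite ler_pdivlMr// mul1r.
Qed.

(** A derivative is a multiple of [(x_k - y_k) |x - y|^(p - 2)], hence at most of order
    [|x - y|^p / d] because [d <= |x - y|]. The exponent changes from [p] to [p - 2], so the
    induction on [m] keeps [p] general. *)
Lemma deriv_bound_dist_pow m p : exists2 C, 0 <= C & forall x y d, U x -> ~ U y ->
  0 < d -> d <= eucl_dist x y ->
  deriv_bound m x d (C * eucl_dist x y `^ p) (fun z => eucl_dist z y `^ p).
Proof.
elim: m p => [|m IH] p.
  exists 1 => // x y d Ux Uy d0 dxy; apply/deriv_bound0.
  by rewrite mul1r ger0_norm// powR_ge0.
have [C C0 H] := IH (p - 2).
exists (1 + `|p| * (2 ^+ m * C)); first by rewrite addr_ge0// !mulr_ge0// exprn_ge0.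
move=> x y d Ux Uy d0 dxy; have xy0 : 0 < eucl_dist x y by exact: lt_le_trans dxy.
have P0 : 0 <= 2 ^+ m * C by rewrite !mulr_ge0// exprn_ge0.
apply/deriv_boundS => //; split=> [|k].
  rewrite ger0_norm ?powR_ge0// ler_peMl ?powR_ge0// lerDl mulr_ge0//.
have sc := @smooth_coord _ _ U k (y ord0 k) oU.
have sp := smooth_dist_pow (p - 2) Uy.
have := deriv_boundZ oU p Ux (ltW d0) (smoothM oU sc sp)
  (deriv_boundM oU Ux d0 sc sp (@deriv_bound_coord m x y k d Ux d0 dxy) (H x y d Ux Uy d0 dxy)).
move=> /(eq_deriv_bound oU Ux (fun z Uz => esym (partial_dist_pow p k Uz Uy))).
apply: deriv_bound_le => //; first exact: ltW.
have -> : eucl_dist x y `^ p = eucl_dist x y * (eucl_dist x y * eucl_dist x y `^ (p - 2)).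
  rewrite -[X in X * (X * _)](powRr1 (ltW xy0)) -!powRD ?(gt_eqF xy0) ?implybT//.
  by congr (_ `^ _); ring.
move: dxy xy0 P0 (powR_ge0 (eucl_dist x y) (p - 2)) {H}.
move: (eucl_dist x y) (_ `^ _) (2 ^+ m) => r w c dr r0 P0 w0.
rewrite ler_pdivlMr//; apply: (@le_trans _ _ (`|p| * (c * C) * (r * (r * w)))).
  rewrite [leLHS](_ : _ = `|p| * (c * C) * (r * w) * d); last by ring.
  rewrite [leRHS](_ : _ = `|p| * (c * C) * (r * w) * r); last by ring.
  apply: ler_wpM2l => //.
  exact: (mulr_ge0 (mulr_ge0 (normr_ge0 p) P0) (mulr_ge0 (ltW r0) w0)).
apply: ler_wpM2r; last by rewrite lerDr.
exact: (mulr_ge0 (ltW r0) (mulr_ge0 (ltW r0) w0)).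
Qed.

End DistancePowers.

(** * Differentiation under the integral sign *)

Section BorelIntegrals.
Context {R : realType} {n : nat} (mu : probability (borel R n) R).
Implicit Types (E : set 'rV[R]_n) (u v : 'rV[R]_n -> R).

Lemma open_measurable_borel (U : set 'rV[R]_n) : open U -> measurable (U : set (borel R n)).
Proof. by move=> oU; exact: sub_sigma_algebra. Qed.

Lemma compact_measurable_borel E : compact E -> measurable (E : set (borel R n)).
Proof.
move=> cE; rewrite -[E]setCK; apply: measurableC; apply: open_measurable_borel.
by apply: closed_openC; apply: compact_closed cE; exact: norm_hausdorff.
Qed.

Lemma within_continuous_measurable E u : measurable (E : set (borel R n)) ->
  {within E, continuous u} -> measurable_fun (E : set (borel R n)) (u : borel R n -> R).
Proof.
move=> mE /continuousP cu; apply: (measurability _ (RGenOpens.measurableE R)).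
move=> _ [_ [a [b ->] <-]].
have /open_subspaceP[V oV VE] : open (u @^-1` `]a, b[%classic : set (subspace E)).
  by apply: cu; exact: interval_open.
by rewrite setIC -VE; apply: measurableI => //; exact: open_measurable_borel.
Qed.

Lemma continuous_measurable_borel E u : measurable (E : set (borel R n)) ->
  continuous u -> measurable_fun (E : set (borel R n)) (u : borel R n -> R).
Proof.
by move=> mE cu; apply: within_continuous_measurable => //; exact: continuous_subspaceT.
Qed.

Variable E : set 'rV[R]_n.
Hypothesis mE : measurable (E : set (borel R n)).

Lemma bounded_integrable u (M : R) :
  measurable_fun (E : set (borel R n)) (u : borel R n -> R) ->
  (forall y, E y -> `|u y| <= M) -> mu.-integrable E (EFin \o (u : borel R n -> R)).
Proof.
move=> mu_ uM; apply: measurable_bounded_integrable => //.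
  by apply: le_lt_trans (ltry 1); exact: probability_le1.
exists M; split; first exact: num_real.
by move=> x Mx y Ey; apply: le_trans (uM y Ey) _; exact: ltW.
Qed.

Lemma normr_Rintegral_le u v :
  mu.-integrable E (EFin \o (u : borel R n -> R)) ->
  mu.-integrable E (EFin \o (v : borel R n -> R)) ->
  (forall y, E y -> `|u y| <= v y) ->
  `|\int[mu]_(y in E) u y| <= \int[mu]_(y in E) v y.
Proof.
move=> iu iv uv; apply: le_trans (le_normr_Rintegral mE iu) _.
by apply: le_Rintegral => //; exact: (integrable_norm iu).
Qed.

Lemma integrable_cst_borel (M : R) : mu.-integrable E (EFin \o (cst M : borel R n -> R)).
Proof. by apply: (@bounded_integrable _ `|M|) => //; exact: measurable_cst. Qed.

Lemma normr_Rintegral_bound u (M : R) : 0 <= M ->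
  measurable_fun (E : set (borel R n)) (u : borel R n -> R) ->
  (forall y, E y -> `|u y| <= M) -> `|\int[mu]_(y in E) u y| <= M.
Proof.
move=> M0 mu_ uM; have iu := bounded_integrable mu_ uM.
apply: le_trans (normr_Rintegral_le iu (integrable_cst_borel M) uM) _.
rewrite Rintegral_cst// ler_piMr// -lee_fin fineK ?probability_le1//.
by apply: fin_num_measure.
Qed.

End BorelIntegrals.

(** * Smooth kernels and the derivatives of their integrals *)

Section DifferentiationUnderIntegral.
Context {R : realType} {n : nat} (mu : probability (borel R n) R).
Variables (U E : set 'rV[R]_n).
Hypotheses (oU : open U) (mE : measurable (E : set (borel R n))).
Implicit Types (u : 'rV[R]_n -> 'rV[R]_n -> R).

(** A quadratic error bound that is uniform in a parameter survives integration over it; this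
    criterion takes the place of dominated convergence. *)
Lemma is_derive_quadratic (f : 'rV[R]_n -> R) x (v : 'rV[R]_n) (b M delta : R) : 0 < delta ->
  (forall t : R, `|t| <= delta -> `|f (t *: v + x) - f x - t * b| <= M * t ^+ 2) ->
  is_derive x v f b.
Proof.
move=> delta0 H.
have cf : h^-1 *: ((f \o shift x) (h *: v) - f x) @[h --> (0 : R)^'] --> b.
  apply/cvgrPdist_le => e e0; near=> h.
  have h0 : h != 0 by near: h; exact: nbhs_dnbhs_neq.
  have hd : `|h| <= delta.
    by near: h; apply: dnbhs0_le.
  have -> : b - h^-1 *: ((f \o shift x) (h *: v) - f x) =
      - (h^-1 * (f (h *: v + x) - f x - h * b)).
    by rewrite /= -[_ *: _]/(_ * _) [in RHS]mulrBr mulrA mulVf// mul1r opprB.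
  rewrite normrN normrM normfV ler_pdivrMl ?normr_gt0//.
  apply: le_trans (H h hd) _; rewrite -real_normK ?num_real// expr2 mulrA [leRHS]mulrC.
  apply: ler_wpM2r => //; apply: (@le_trans _ _ ((`|M| + 1) * `|h|)).
    by apply: ler_wpM2r => //; rewrite ler_wpDr// ler_norm.
  rewrite -ler_pdivlMl ?ltr_wpDl//; near: h; apply: dnbhs0_le.
  by rewrite mulr_gt0// invr_gt0 ltr_wpDl.
split; last by apply: cvg_lim cf.
by apply/cvg_ex; exists b.
Unshelve. all: by end_near. Qed.

(* Joint hypotheses under which [x |-> \int u x y] may be differentiated any
   number of times; they are inherited by the partial derivatives of [u]. *)
Definition smooth_kernel u :=
  [/\ forall y, E y -> smooth_on U (u^~ y),
      forall x, U x -> measurable_fun (E : set (borel R n)) (u x : borel R n -> R) &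
      forall m x, U x -> exists delta M : R, [/\ 0 < delta, 0 <= M &
        forall z, eucl_dist z x <= delta ->
          U z /\ forall y, E y -> deriv_bound m z 1 M (u^~ y)]].

Lemma smooth_kernel_integrable u x : smooth_kernel u -> U x ->
  mu.-integrable E (EFin \o (u x : borel R n -> R)).
Proof.
move=> [_ mu_ bu] Ux; have [delta [M [d0 M0 H]]] := bu 0 x Ux.
apply: (bounded_integrable mu mE (mu_ x Ux)) => y Ey.
have [|_ bx] := H x; first by rewrite eucl_distxx ltW.
exact: deriv_bound_at (bx y Ey).
Qed.

(** Two applications of the mean value theorem along the same axis, with [M] and [delta] uniform in
    [y]. *)
Lemma smooth_kernel_taylor2 u x i : smooth_kernel u -> U x ->
  exists delta M : R, [/\ 0 < delta, 0 <= M & forall t : R, `|t| <= delta ->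
    U (t *: delta_mx ord0 i + x) /\ forall y, E y ->
    `|u (t *: delta_mx ord0 i + x) y - u x y - t * partial i (u^~ y) x| <= M * t ^+ 2].
Proof.
move=> [su _ bu] Ux; have [delta [M [d0 M0 H]]] := bu 2 x Ux.
exists delta, M; split=> // t td.
have inU (r : R) : `|r| <= `|t| -> U (r *: delta_mx ord0 i + x) /\ forall y, E y ->
    `|partial i (partial i (u^~ y)) (r *: delta_mx ord0 i + x)| <= M.
  move=> rt; have [|Uz bz] := H (r *: delta_mx ord0 i + x).
    by rewrite eucl_dist_axis (le_trans rt).
  by split=> // y Ey; have := bz y Ey [:: i; i] isT; rewrite /= expr1n mulr1.
split=> [|y Ey]; first by have [] := inU t.
have [r /inU[Ur _]|r rt ->] := @axis_mvt _ _ (u^~ y) x i t.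
  exact: (smooth_derivable (su y Ey) Ur).
have [r' r'r|r' r'r E'] := @axis_mvt _ _ (partial i (u^~ y)) x i r.
  have [Ur' _] := inU r' (le_trans r'r rt).
  exact: (smooth_derivable (smooth_partial i (su y Ey)) Ur').
rewrite -mulrBr E' normrM normrM -[leRHS]mulrC -real_normK ?num_real// expr2 -mulrA.
apply: ler_wpM2l => //; apply: ler_pM => //.
by have [_ /(_ y Ey)] := inU r' (le_trans r'r rt).
Qed.

Lemma smooth_kernel_partial u i : smooth_kernel u ->
  smooth_kernel (fun x y => partial i (u^~ y) x).
Proof.
move=> ku; have [su mu_ bu] := ku; split=> [y Ey|x Ux|m x Ux].
- exact: smooth_partial (su y Ey).
- have [delta [M [d0 M0 H]]] := smooth_kernel_taylor2 i ku Ux.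
  (* The derivative is measurable in [y] as the pointwise limit of the difference quotients with
     increments [t m]. *)
  pose t (m : nat) : R := delta / m.+1%:R.
  have t0 m : 0 < t m by rewrite divr_gt0.
  have td m : `|t m| <= delta.
    by rewrite gtr0_norm// ler_pdivrMr// ler_peMr// ?ler1n// ltW.
  apply: (@measurable_fun_cvg _ (borel R n) R _
    (fun m (y : borel R n) => (t m)^-1 * (u (t m *: delta_mx ord0 i + x) y - u x y))) => [m|y Ey].
    apply: measurable_funM => //; apply: measurable_funB; last exact: mu_.
    by apply: mu_; have [] := H _ (td m).
  apply/cvgrPdist_le => e e0.
  have P : 0 < M * delta + 1 by rewrite ltr_wpDl// mulr_ge0// ltW.
  have Q : 0 < (M * delta + 1)^-1 * e by rewrite mulr_gt0// invr_gt0.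
  near=> m.
  have [_ /(_ y Ey) Hm] := H _ (td m).
  have -> : partial i (u^~ y) x - (t m)^-1 * (u (t m *: delta_mx ord0 i + x) y - u x y) =
      - ((t m)^-1 * (u (t m *: delta_mx ord0 i + x) y - u x y - t m * partial i (u^~ y) x)).
    by rewrite [in RHS]mulrBr mulrA mulVf ?lt0r_neq0// mul1r opprB.
  rewrite normrN normrM normfV ler_pdivrMl ?normr_gt0 ?lt0r_neq0//.
  apply: le_trans Hm _; rewrite -real_normK ?num_real// expr2 mulrA [leRHS]mulrC.
  apply: ler_wpM2r => //; rewrite gtr0_norm// /t mulrA.
  apply: (@le_trans _ _ ((M * delta + 1) * m.+1%:R^-1)).
    by apply: ler_wpM2r; rewrite ?lerDl// invr_ge0.
  rewrite -ler_pdivlMl//; apply: ltW; near: m.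
  exact: (near_infty_natSinv_lt (PosNum Q)).
- have [delta [M [d0 M0 H]]] := bu m.+1 x Ux.
  exists delta, M; split=> // z zd; have [Uz bz] := H z zd; split=> // y Ey.
  by have [_ /(_ i)] := (deriv_boundS m z M (u^~ y) ltr01).1 (bz y Ey); rewrite divr1.
Unshelve. all: by end_near. Qed.

Lemma smooth_kernel_partials u s : smooth_kernel u ->
  smooth_kernel (fun x y => partials s (u^~ y) x).
Proof. by elim: s => [//|i s IH] /IH; exact: smooth_kernel_partial. Qed.

Lemma is_derive_Rintegral u x i : smooth_kernel u -> U x ->
  is_derive x (delta_mx ord0 i) (fun x => \int[mu]_(y in E) u x y)
    (\int[mu]_(y in E) partial i (u^~ y) x).
Proof.
move=> ku Ux; have [delta [M [d0 M0 H]]] := smooth_kernel_taylor2 i ku Ux.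
apply: (is_derive_quadratic d0) => t td; have [Uz Hz] := H t td.
have iz := smooth_kernel_integrable ku Uz; have ix := smooth_kernel_integrable ku Ux.
have ip := smooth_kernel_integrable (smooth_kernel_partial i ku) Ux.
have iB : mu.-integrable E (EFin \o (fun y => u (t *: delta_mx ord0 i + x) y - u x y : R)).
  exact: (integrableB mE iz ix).
have iZ : mu.-integrable E (EFin \o (fun y => t * partial i (u^~ y) x : R)).
  exact: (integrableZl mE t ip).
rewrite -(RintegralB mE iz ix) -(RintegralZl t mE ip) -(RintegralB mE iB iZ).
apply: (normr_Rintegral_bound mu mE _ _ Hz); first by rewrite mulr_ge0// sqr_ge0.
by case/integrableP: (integrableB mE iB iZ) => /measurable_EFinP.
Qed.

Lemma Rintegral_continuous u x : smooth_kernel u -> U x ->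
  {for x, continuous (fun x => \int[mu]_(y in E) u x y)}.
Proof.
move=> ku Ux; have [su _ bu] := ku; have [delta [M [d0 M0 H]]] := bu 1 x Ux.
have ix := smooth_kernel_integrable ku Ux.
have L z : eucl_dist z x <= delta ->
    `|\int[mu]_(y in E) u z y - \int[mu]_(y in E) u x y| <= n%:R * (M * eucl_dist z x).
  move=> zd; have [Uz _] := H z zd; have iz := smooth_kernel_integrable ku Uz.
  rewrite -(RintegralB mE iz ix); apply: normr_Rintegral_bound => //.
  - by rewrite !mulr_ge0// eucl_dist_ge0.
  - by case/integrableP: (integrableB mE iz ix) => /measurable_EFinP.
  move=> y Ey; apply: (@ball_mvt _ _ (u^~ y) x z delta M zd M0) => w i /H[Uw bw]; split.
    exact: (smooth_derivable (su y Ey) Uw).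
  by have := bw y Ey [:: i] isT; rewrite /= expr1n mulr1.
have P : 0 < n%:R * M + 1 by rewrite ltr_wpDl// mulr_ge0.
apply/(@cvgrPdist_le _ _ _ (nbhs x)) => e e0.
have Q : 0 < (n%:R * M + 1)^-1 * e by rewrite mulr_gt0// invr_gt0.
apply: filterS2 (near_eucl_dist x d0) (near_eucl_dist x Q) => z zd ze.
rewrite distrC; apply: le_trans (L z (ltW zd)) _.
rewrite mulrA; apply: (@le_trans _ _ ((n%:R * M + 1) * eucl_dist z x)).
  by apply: ler_wpM2r; rewrite ?eucl_dist_ge0// lerDl.
by rewrite -ler_pdivlMl// ltW.
Qed.

Lemma partials_Rintegral u s x : smooth_kernel u -> U x ->
  partials s (fun x => \int[mu]_(y in E) u x y) x =
  \int[mu]_(y in E) partials s (u^~ y) x.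
Proof.
move=> ku; elim: s x => [//|i s IH] x Ux /=.
have [_ <-] := is_derive_Rintegral i (smooth_kernel_partials s ku) Ux.
exact: (eq_partials oU IH [:: i]).
Qed.

Lemma smooth_Rintegral u : smooth_kernel u ->
  smooth_on U (fun x => \int[mu]_(y in E) u x y).
Proof.
move=> ku.
have sub s : smooth_upto 0 U (fun x => \int[mu]_(y in E) partials s (u^~ y) x).
  move=> t x; rewrite leqn0 => /nilP -> Ux /=; have ks := smooth_kernel_partials s ku.
  split=> [|i]; first exact: (Rintegral_continuous ks).
  by have [] := is_derive_Rintegral i ks Ux.
move=> s x Ux.
have E1 z : U z -> \int[mu]_(y in E) partials s (u^~ y) z =
    partials s (fun x => \int[mu]_(y in E) u x y) z.
  by move=> Uz; rewrite partials_Rintegral.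
by have /(_ [::] x isT Ux) := eq_smooth_upto oU E1 (sub s).
Qed.

End DifferentiationUnderIntegral.

(** * Homogeneous measures *)

Section HomogeneousMeasure.
Context {R : realType} {n : nat} (mu : probability (borel R n) R).
Variables (E : set 'rV[R]_n) (upsilon : R).
Hypothesis cE : compact E.
Hypothesis mu_on_E : mu E = 1%E.
Hypothesis mu_support : forall (x : 'rV[R]_n) (r : R), E x -> 0 < r ->
  (0 < mu (E `&` mball eucl_dist x r))%E.
Hypothesis mu_U : U_class (T := borel R n) eucl_dist E mu upsilon.

Let mE : measurable (E : set (borel R n)) := compact_measurable_borel cE.

Definition ball_mass (x : 'rV[R]_n) (r : R) : R := fine (mu (E `&` mball eucl_dist x r)).

Lemma measurable_mball (x : 'rV[R]_n) (r : R) :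
  measurable (mball eucl_dist x r : set (borel R n)).
Proof.
apply: open_measurable_borel; rewrite openE => y /= xy.
have := @eucl_dist_continuousr _ _ x y => /cvgr_lt; exact.
Qed.

Let mB (x : 'rV[R]_n) (r : R) : measurable (E `&` mball eucl_dist x r : set (borel R n)).
Proof. by apply: measurableI => //; exact: measurable_mball. Qed.

Lemma ball_massE x r : (ball_mass x r)%:E = mu (E `&` mball eucl_dist x r).
Proof. by rewrite fineK//; apply: fin_num_measure; exact: mB. Qed.

Lemma ball_mass_le1 x r : ball_mass x r <= 1.
Proof. by rewrite -lee_fin ball_massE; apply: probability_le1; exact: mB. Qed.

Lemma ball_mass_gt0 x r : E x -> 0 < r -> 0 < ball_mass x r.
Proof. by move=> Ex r0; rewrite -lte_fin ball_massE; exact: mu_support. Qed.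

Lemma ball_mass_mono x y r r' : mball eucl_dist x r `<=` mball eucl_dist y r' ->
  ball_mass x r <= ball_mass y r'.
Proof.
move=> BB; rewrite -lee_fin !ball_massE; apply: le_measure; rewrite ?inE; try exact: mB.
exact: setIS.
Qed.

Lemma ball_mass_le x r r' : r <= r' -> ball_mass x r <= ball_mass x r'.
Proof. by move=> rr; apply: ball_mass_mono => y /= /lt_le_trans; apply. Qed.

Lemma E_nonempty : exists e, E e.
Proof.
apply: contrapT => nE; have E0 : E = set0.
  by apply/seteqP; split=> // e Ee; apply: nE; exists e.
by move: mu_on_E; rewrite E0 measure0 => /eqP; rewrite eq_sym onee_eq0.
Qed.

Lemma ball_mass_doubling : exists2 C, 1 <= C & forall x r k, E x -> 0 < r -> 1 < k ->
  k * r <= 1 -> ball_mass x (k * r) <= C * k `^ upsilon * ball_mass x r.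
Proof.
have [C HC] := mu_U; exists (Num.max 1 C); first by rewrite le_max lexx.
move=> x r k Ex r0 k1 kr; have := HC x r k Ex r0 _ kr.
rewrite -!ball_massE -EFinM lee_fin ltr_pMl// => /(_ k1)/le_trans; apply.
apply: ler_wpM2r; first by apply/ltW/ball_mass_gt0.
by apply: ler_wpM2r; rewrite ?powR_ge0// le_max lexx orbT.
Qed.

(** Were [upsilon] negative, comparing the balls of radius [1] and [1 / k] around a point of [E]
    would bound the mass of the former by [C k^upsilon], which tends to zero. The proof takes [k]
    with [k^upsilon = c / (2 C)], where [c] is that mass. *)
Lemma upsilon_ge0 : 0 <= upsilon.
Proof.
have [e Ee] := E_nonempty; have [C C1 HC] := ball_mass_doubling.
rewrite leNgt; apply/negP => u0.
have C0 : 0 < C by exact: lt_le_trans C1.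
have c0 := ball_mass_gt0 Ee ltr01; set c := ball_mass e 1 in c0.
have c1 : c <= 1 by exact: ball_mass_le1.
set t := c / (2 * C).
have t0 : 0 < t by rewrite divr_gt0// mulr_gt0.
have t1 : t < 1.
  rewrite ltr_pdivrMr ?mulr_gt0// mul1r; apply: le_lt_trans c1 _.
  by apply: (@lt_le_trans _ _ 2); rewrite ?ltr1n// ler_peMr.
set k := t `^ upsilon^-1.
have k1 : 1 < k.
  rewrite /k -[upsilon^-1]opprK powRN invf_gt1 ?powR_gt0//.
  have -> : 1 = 1 `^ (- upsilon^-1) :> R by rewrite powR1.
  by apply: gt0_ltr_powR; rewrite ?oppr_gt0 ?invr_lt0// nnegrE ltW.
have k0 : 0 < k by exact: lt_trans k1.
have ku : k `^ upsilon = t by rewrite /k -powRrM (mulVf (ltr0_neq0 u0)) powRr1// ltW.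
have := HC e k^-1 k Ee; rewrite invr_gt0 mulfV ?lt0r_neq0// ku => /(_ k0 k1 (lexx _)).
rewrite -/c; apply/negP; rewrite -ltNge.
apply: (@le_lt_trans _ _ (C * t * 1)).
  by apply: ler_wpM2l; [rewrite mulr_ge0// ltW|exact: ball_mass_le1].
rewrite /t (_ : C * (c / (2 * C)) * 1 = c / 2); last by field; rewrite lt0r_neq0.
by rewrite ltr_pdivrMr// ltr_pMr// ltr1n.
Qed.

(** Compactness: for [y] within [1/2] of [x], the unit ball around [y] contains the ball of radius
    [1/2] around [x], which has positive mass. *)
Lemma ball_mass_lower_bound : exists2 c, 0 < c & forall e, E e -> c <= ball_mass e 1.
Proof.
have H : \forall c \near (0 : R)^'+, E `<=` [set e | E e -> c <= ball_mass e 1].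
  apply: ((compact_near_coveringP E).1 cE R ((0 : R)^'+)
    (fun c e => E e -> c <= ball_mass e 1)) => x Ex.
  have m0 : 0 < ball_mass x 2^-1 by apply: ball_mass_gt0; rewrite ?invr_gt0.
  exists ([set y | eucl_dist y x < 2^-1], [set c | c <= ball_mass x 2^-1]) => /=.
    split; first by apply: near_eucl_dist; rewrite invr_gt0.
    exact: nbhs_right_le.
  move=> [y c] /= [yx cx] Ey; apply: le_trans cx _; apply: ball_mass_mono => z /= xz.
  apply: le_lt_trans (eucl_dist_triangle x _ _) _.
  by rewrite [ltRHS](splitr 1) mul1r ltrD.
near (0 : R)^'+ => c.
exists c; first by near: c; exact: nbhs_right_gt.
by move=> e Ee; have : E `<=` [set e | E e -> c <= ball_mass e 1]; [near: c|apply].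
Unshelve. all: by end_near. Qed.

(** Removes the restriction [k * r <= 1]. When [k * r > 1] the left side is at most [1], and
    [k^upsilon] times the mass at radius [r] stays above [c / C]: for [r < 1] by comparing with the
    unit ball, since [k > 1 / r], and for [r >= 1] by monotonicity. *)
Lemma ball_mass_homogeneous : exists2 C, 1 <= C & forall x r k, E x -> 0 < r -> 1 <= k ->
  ball_mass x (k * r) <= C * k `^ upsilon * ball_mass x r.
Proof.
have u0 := upsilon_ge0; have [C C1 HC] := ball_mass_doubling.
have [c c0 Hc] := ball_mass_lower_bound.
have C0 : 0 < C by exact: lt_le_trans C1.
have kC (a k m : R) : C <= a -> 0 <= m -> C * k `^ upsilon * m <= a * k `^ upsilon * m.
  by move=> Ca m0; rewrite ler_wpM2r// ler_wpM2r// powR_ge0.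
exists (C + C / c); first by rewrite ler_wpDr// divr_ge0 ?ltW.
move=> x r k Ex r0 k1; have m0 := ball_mass_gt0 Ex r0.
have Cc0 : 0 <= C / c by rewrite divr_ge0 ?ltW.
have k0 : 0 < k by exact: lt_le_trans k1.
have ku1 : 1 <= k `^ upsilon.
  by rewrite -[leLHS](powRr0 k) ler_powR.
have [kr|kr] := leP (k * r) 1.
  apply: le_trans (kC _ _ _ (_ : C <= _) (ltW m0)); last by rewrite lerDl.
  have [k1'|kn1] := ltP 1 k; first exact: HC.
  have -> : k = 1 by apply/eqP; rewrite eq_le kn1 k1.
  by rewrite mul1r powR1 mulr1 ler_peMl// ltW.
have step : C^-1 * c <= k `^ upsilon * ball_mass x r.
  have [r1|r1] := ltP r 1.
    have ru : r^-1 `^ upsilon <= k `^ upsilon.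
      by apply: ge0_ler_powR; rewrite ?nnegrE ?invr_ge0 ?(ltW r0) ?(ltW k0)// -[leLHS]mul1r ler_pdivrMr// ltW.
    have := HC x r r^-1 Ex r0; rewrite mulVf ?lt0r_neq0// invf_gt1// => /(_ r1 (lexx _)) H.
    rewrite ler_pdivrMl//; apply: le_trans (Hc x Ex) _; apply: le_trans H _.
    by rewrite -mulrA ler_pM2l// ler_wpM2r// ltW.
  apply: (@le_trans _ _ (ball_mass x r)); last by rewrite ler_peMl// ltW.
  apply: le_trans (ball_mass_le x r1); apply: le_trans (Hc x Ex).
  by rewrite ler_piMl ?invf_le1// ltW.
apply: (le_trans (ball_mass_le1 _ _)).
apply: (@le_trans _ _ (C / c * k `^ upsilon * ball_mass x r)); last first.
  rewrite ler_wpM2r ?(ltW m0)// ler_wpM2r ?powR_ge0// lerDr ltW//.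
rewrite -mulrA -ler_pdivrMl ?divr_gt0// mulr1 invf_div mulrC; exact: step.
Qed.

Lemma measurable_dist_pow (x : 'rV[R]_n) (p : R) :
  measurable_fun (E : set (borel R n)) ((fun y => eucl_dist x y `^ p) : borel R n -> R).
Proof.
apply: (measurableT_comp (measurable_powR p)).
by apply: continuous_measurable_borel => //; exact: eucl_dist_continuousr.
Qed.

Lemma integrable_dist_pow (x : 'rV[R]_n) (p d : R) : 0 < d -> 0 <= p ->
  (forall y, E y -> d <= eucl_dist x y) ->
  mu.-integrable E (EFin \o ((fun y => eucl_dist x y `^ (- p)) : borel R n -> R)).
Proof.
move=> d0 p0 dE; apply: (@bounded_integrable _ _ _ _ mE _ (d `^ (- p))).
  exact: measurable_dist_pow.
move=> y Ey; rewrite ger0_norm ?powR_ge0// !powRN lef_pV2 ?posrE ?powR_gt0//.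
  by apply: ge0_ler_powR; rewrite ?nnegrE ?(ltW d0) ?eucl_dist_ge0//; exact: dE.
exact: lt_le_trans (dE y Ey).
Qed.

(** These step functions are the comparison functions for the moments of the distance: many balls
    for the upper bound, a single one for the lower bound. *)
Lemma Rintegral_sum_indic (N : nat) (a : nat -> R) (x : 'rV[R]_n) (r : nat -> R) :
  let s := fun y : borel R n => \sum_(k < N) a k * \1_(mball eucl_dist x (r k)) y in
  mu.-integrable E (EFin \o s) /\
  \int[mu]_(y in E) s y = \sum_(k < N) a k * ball_mass x (r k).
Proof.
have iI (rho : R) : mu.-integrable E
    (EFin \o (\1_(mball eucl_dist x rho) : borel R n -> R)).
  apply: (@bounded_integrable _ _ _ _ mE _ 1).
    by apply: measurable_indic; exact: measurable_mball.
  by move=> y _; rewrite normr_nat lern1 leq_b1.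
have vI (rho : R) : \int[mu]_(y in E) \1_(mball eucl_dist x rho) y = ball_mass x rho.
  rewrite /Rintegral integral_indic//; last exact: measurable_mball.
  by rewrite setIC.
elim: N => [|N [iN vN]] /=.
  split.
    rewrite (_ : _ \o _ = EFin \o (cst 0 : borel R n -> R)); first exact: integrable_cst_borel.
    by apply/funext => y /=; rewrite big_ord0.
  rewrite big_ord0 -[RHS](mul0r (fine (mu E))) -Rintegral_cst//.
  by apply: eq_Rintegral => y _; rewrite big_ord0.
have iZ : mu.-integrable E (EFin \o (fun y : borel R n => a N * \1_(mball eucl_dist x (r N)) y)).
  exact: (integrableZl mE (a N) (iI (r N))).
split.
  rewrite (_ : _ \o _ = EFin \o (fun y : borel R n =>
    (\sum_(k < N) a k * \1_(mball eucl_dist x (r k)) y) + a N * \1_(mball eucl_dist x (r N)) y)).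
    exact: (integrableD mE iN iZ).
  by apply/funext => y /=; rewrite big_ord_recr.
rewrite big_ord_recr /= -vN -vI -RintegralZl// -RintegralD//.
by apply: eq_Rintegral => y _; rewrite big_ord_recr.
Qed.

Lemma geometric_sum_le (t : R) (N : nat) : 0 <= t -> t < 1 ->
  \sum_(k < N) t ^+ k <= (1 - t)^-1.
Proof.
move=> t0 t1; have t10 : 0 < 1 - t by rewrite subr_gt0.
rewrite -[leRHS]mul1r ler_pdivlMr// mulrC -opprB mulNr -subrX1 opprB.
by rewrite gerBl exprn_ge0.
Qed.

(** [k] is the least scale whose ball around [e] contains [y]. Let [d = |x - e|]. For [k > 0]
    minimality gives [|e - y| >= 2^(k-1) d], while [|e - y| <= d + |x - y| <= 2 |x - y|]; together
    these produce the factor [4]. *)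
Lemma dyadic_scale (x e y : 'rV[R]_n) : E e -> E y -> 0 < eucl_dist x e ->
  (forall z, E z -> eucl_dist x e <= eucl_dist x z) ->
  exists2 k : nat, eucl_dist e y < 2 ^+ k * eucl_dist x e &
    2 ^+ k * eucl_dist x e / 4 <= eucl_dist x y /\
    (forall N : nat, eucl_dist e y < 2 ^+ N * eucl_dist x e -> (k <= N)%N).
Proof.
move=> Ee Ey d0 dE; set d := eucl_dist x e in d0 dE *.
have exP : exists N : nat, eucl_dist e y < 2 ^+ N * d.
  exists (Num.truncn (eucl_dist e y / d)).+1; rewrite -ltr_pdivrMr//.
  apply: lt_le_trans (truncnS_gt _) _.
  by rewrite -natrX ler_nat ltnW// ltn_expl.
case: (ex_minnP exP) => k yk kmin; exists k => //; split=> //.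
have dy := dE y Ey.
case: k yk kmin => [|k] yk kmin.
  by apply: le_trans dy; rewrite expr0 mul1r ler_pdivrMr// ler_peMr ?(ltW d0)// ler1n.
have : 2 ^+ k * d <= eucl_dist e y.
  by rewrite leNgt; apply/negP => /kmin; rewrite ltnn.
have := eucl_dist_triangle x e y; rewrite (eucl_distC e x) -/d exprS.
move: (eucl_dist e y) (eucl_dist x y) (2 ^+ k) dy => a b c; lra.
Qed.

(* Split [E] into dyadic shells around the point [e] of [E] nearest to [x]: on
   the [k]-th shell the integrand is of order [(2 ^ k d)^-p], and homogeneity
   bounds the mass of the shell by [2 ^ (k upsilon)] times that of [B(e, d)]. *)
Lemma dist_moment_le (p : R) : upsilon < p -> exists2 K, 0 <= K & forall x e : 'rV[R]_n,
  E e -> 0 < eucl_dist x e -> (forall z, E z -> eucl_dist x e <= eucl_dist x z) ->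
  \int[mu]_(y in E) (eucl_dist x y `^ (- p)) <=
  K * eucl_dist x e `^ (- p) * ball_mass e (eucl_dist x e).
Proof.
move=> up; have u0 := upsilon_ge0; have [C C1 HC] := ball_mass_homogeneous.
have p0 : 0 < p by exact: le_lt_trans up.
(* The ratio of the geometric series over the shells, below [1] exactly because [upsilon < p]. *)
set t : R := 2 `^ (upsilon - p).
have t0 : 0 <= t by exact: powR_ge0.
have t1 : t < 1.
  rewrite /t -opprB powRN invf_lt1 ?powR_gt0//.
  have {1}-> : 1 = 1 `^ (p - upsilon) :> R by rewrite powR1.
  by apply: gt0_ltr_powR; rewrite ?subr_gt0 ?nnegrE// ltr1n.
have C0 : 0 <= C by exact: le_trans C1.
exists (4 `^ p * C * (1 - t)^-1).
  by rewrite mulr_ge0 ?mulr_ge0 ?powR_ge0// invr_ge0 subr_ge0 ltW.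
move=> x e Ee d0 dE; set d := eucl_dist x e in d0 dE *.
(* The point of [E] farthest from [e] fixes the last shell, so a finite sum suffices. *)
have [c Ec cmax] : exists2 c, c \in E & forall z, z \in E -> eucl_dist e z <= eucl_dist e c.
  apply: EVT_max_rV => //; first by exists e.
  by apply: continuous_subspaceT; exact: eucl_dist_continuousr.
rewrite inE in Ec.
have [N cN _] := dyadic_scale Ee Ec d0 dE.
pose a (k : nat) := (2 ^+ k * d / 4) `^ (- p).
have := @Rintegral_sum_indic N.+1 a e (fun k => 2 ^+ k * d).
set s := fun y : borel R n => _ => -[iS vS].
have pos (k : nat) : 0 < 2 ^+ k * d / 4 by rewrite divr_gt0// mulr_gt0// exprn_gt0.
apply: (@le_trans _ _ (\int[mu]_(y in E) s y)).
  apply: le_Rintegral => //; first exact: (integrable_dist_pow d0 (ltW p0) dE).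
  move=> y Ey; have [k yk [ky kmin]] := dyadic_scale Ee Ey d0 dE.
  have kN : (k < N.+1)%N.
    by rewrite ltnS; apply: kmin; apply: le_lt_trans cN; apply: cmax; rewrite inE.
  (* The term at the scale [k] of [y] alone dominates the integrand; the other terms are
     nonnegative. *)
  rewrite /s (bigD1 (Ordinal kN))//= indicE mem_set// mulr1.
  apply: ler_wpDr.
    by apply: sumr_ge0 => i _; rewrite mulr_ge0 ?powR_ge0.
  rewrite /a !powRN lef_pV2 ?posrE ?powR_gt0//; last exact: lt_le_trans (dE y Ey).
  by apply: ge0_ler_powR; rewrite ?nnegrE ?(ltW p0) ?(ltW (pos k)) ?eucl_dist_ge0.
rewrite vS; have m0 : 0 <= ball_mass e d by exact/ltW/ball_mass_gt0.
have term (k : nat) : a k * ball_mass e (2 ^+ k * d) <=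
    4 `^ p * C * d `^ (- p) * ball_mass e d * t ^+ k.
  have k1 : 1 <= 2 ^+ k :> R by rewrite exprn_ege1// ler1n.
  have ak0 : 0 <= a k by exact: powR_ge0.
  apply: (le_trans (ler_wpM2l ak0 (HC e d _ Ee d0 k1))).
  have -> : a k = 4 `^ p * d `^ (- p) * (2 `^ (- p)) ^+ k.
    rewrite /a powRM ?invr_ge0 ?mulr_ge0 ?exprn_ge0 ?(ltW d0)// powRM ?exprn_ge0 ?(ltW d0)//.
    rewrite -(powR_inv1 (_ : 0 <= 4)) // -powRrM mulN1r opprK.
    rewrite -(powR_mulrn k (_ : 0 <= 2)) // -(powR_mulrn k (powR_ge0 _ _)) powRAC.
    by rewrite mulrC [_ * d `^ _]mulrC mulrA.
  have -> : (2 ^+ k : R) `^ upsilon = (2 `^ upsilon) ^+ k.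
    by rewrite -(powR_mulrn k (_ : 0 <= 2)) // -(powR_mulrn k (powR_ge0 _ _)) powRAC.
  have -> : t ^+ k = (2 `^ upsilon) ^+ k * (2 `^ (- p)) ^+ k.
    by rewrite -exprMn /t powRD// pnatr_eq0 implybT.
  rewrite le_eqVlt; apply/orP; left; apply/eqP.
  move: (4 `^ p) (d `^ (- p)) ((2 `^ (- p)) ^+ k) ((2 `^ upsilon) ^+ k) (ball_mass e d).
  by move=> a1 a2 a3 a4 a5; ring.
apply: (@le_trans _ _ (\sum_(k < N.+1) (4 `^ p * C * d `^ (- p) * ball_mass e d * t ^+ k))).
  by apply: ler_sum => k _; exact: term.
rewrite -mulr_sumr; apply: (le_trans (ler_wpM2l _ (geometric_sum_le N.+1 t0 t1))).
  by rewrite !mulr_ge0// powR_ge0.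
rewrite le_eqVlt; apply/orP; left; apply/eqP.
move: (4 `^ p) (d `^ (- p)) ((1 - t)^-1) (ball_mass e d).
by move=> a1 a2 a3 a4; ring.
Qed.

(** Points of the ball around [e] of radius [|x - e|] are within twice that radius of [x], which
    bounds the integrand below there. *)
Lemma ball_mass_le_dist_moment (q : R) (x e : 'rV[R]_n) : 0 <= q ->
  E e -> 0 < eucl_dist x e -> (forall z, E z -> eucl_dist x e <= eucl_dist x z) ->
  (2 * eucl_dist x e) `^ (- q) * ball_mass e (eucl_dist x e) <=
  \int[mu]_(y in E) (eucl_dist x y `^ (- q)).
Proof.
move=> q0 Ee d0 dE; set d := eucl_dist x e in d0 dE *.
have := @Rintegral_sum_indic 1 (fun=> (2 * d) `^ (- q)) e (fun=> d).
rewrite /= big_ord1 => -[iS <-].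
apply: le_Rintegral => //; first exact: (integrable_dist_pow d0 q0 dE).
move=> y Ey; rewrite big_ord1 indicE.
have [|_] := boolP (y \in mball eucl_dist e d); last by rewrite mulr0 powR_ge0.
rewrite inE /= => yd; rewrite mulr1 !powRN lef_pV2 ?posrE ?powR_gt0 ?mulr_gt0//; last first.
  exact: lt_le_trans (dE y Ey).
apply: ge0_ler_powR; rewrite ?nnegrE ?eucl_dist_ge0// ?mulr_ge0 ?(ltW d0)//.
rewrite mulr_natl mulr2n; apply: le_trans (eucl_dist_triangle e _ _) _.
by apply: lerD => //; exact: ltW.
Qed.

(** The upper bound for one moment and the lower bound for the other contain the same mass of the
    ball around [e], which is eliminated. *)
Lemma dist_moment_ratio (p q : R) : upsilon < p -> 0 <= q -> exists2 K, 0 <= K &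
  forall x e : 'rV[R]_n,
  E e -> 0 < eucl_dist x e -> (forall z, E z -> eucl_dist x e <= eucl_dist x z) ->
  \int[mu]_(y in E) (eucl_dist x y `^ (- p)) <=
  K * eucl_dist x e `^ (q - p) * \int[mu]_(y in E) (eucl_dist x y `^ (- q)).
Proof.
move=> up q0; have [K K0 HK] := dist_moment_le up.
exists (K * 2 `^ q); first by rewrite mulr_ge0// powR_ge0.
move=> x e Ee d0 dE; apply: (le_trans (HK x e Ee d0 dE)).
have := ball_mass_le_dist_moment q0 Ee d0 dE.
set d := eucl_dist x e in d0 dE *; set I := \int[mu]_(y in E) _ => H.
have -> : d `^ (q - p) = d `^ q * d `^ (- p).
  by rewrite powRD// lt0r_neq0// implybT.
have {}H : ball_mass e d <= 2 `^ q * d `^ q * I.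
  rewrite -powRM ?(ltW d0)// -ler_pdivrMl ?powR_gt0 ?mulr_gt0// -powRN; exact: H.
rewrite [leRHS](_ : _ = K * d `^ (- p) * (2 `^ q * d `^ q * I)).
  by apply: ler_wpM2l; rewrite ?mulr_ge0// powR_ge0.
by move: (2 `^ q) (d `^ q) (d `^ (- p)) I {H} => a b c I; ring.
Qed.

Lemma dist_moment_gt0 (q : R) (x e : 'rV[R]_n) : 0 <= q ->
  E e -> 0 < eucl_dist x e -> (forall z, E z -> eucl_dist x e <= eucl_dist x z) ->
  0 < \int[mu]_(y in E) (eucl_dist x y `^ (- q)).
Proof.
move=> q0 Ee d0 dE; apply: lt_le_trans (ball_mass_le_dist_moment q0 Ee d0 dE).
by rewrite mulr_gt0 ?powR_gt0 ?mulr_gt0//; exact: ball_mass_gt0.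
Qed.

End HomogeneousMeasure.

(** * Lipschitz jets *)

Section LipschitzJets.
Context {R : realType} {n : nat}.
Implicit Types (x y z e : 'rV[R]_n) (j : multiindex n) (s : seq 'I_n) (a L rho : R).
Implicit Types (F : set 'rV[R]_n) (f : multiindex n -> 'rV[R]_n -> R).

Lemma remainder_diag a f j y : mindices a j -> remainder a f j y y = 0.
Proof.
move=> ja; rewrite /remainder /Dmulti -[flatten _]/(mseq j) partials_taylor_diag.
  by rewrite madd_mseq subrr.
by rewrite size_mseq.
Qed.

Lemma lip_norm_bound a F f : (lip_norm a F f < +oo)%E ->
  exists2 L, 0 <= L & forall j, mindices a j ->
    (forall x, F x -> `|f j x| <= L) /\
    (forall x y, F x -> F y ->
       `|remainder a f j y x| <= L * eucl_dist x y `^ (a - (mdegree j)%:R)).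
Proof.
(* Over the empty set the suprema are [-oo]; a point [x0] is what makes each of them nonnegative. *)
have [->|/set0P[x0 Fx0]] := eqVneq F set0; first by exists 0.
pose S1 j := ereal_sup [set `|f j x|%:E | x in F].
pose S2 j := ereal_sup [set (`|remainder a f j y x| /
   eucl_dist x y `^ (a - (mdegree j)%:R))%:E | x in F & y in F].
rewrite /lip_norm => H.
have S10 j : (0 <= S1 j)%E.
  by apply: le_ereal_sup_tmp; exists (`|f j x0|%:E); [exists x0|rewrite lee_fin].
have S20 j : (0 <= S2 j)%E.
  apply: le_ereal_sup_tmp; exists ((`|remainder a f j x0 x0| /
    eucl_dist x0 x0 `^ (a - (mdegree j)%:R))%:E).
    by exists x0 => //; exists x0.
  by rewrite lee_fin divr_ge0// powR_ge0.
set S := (\sum_(j \in mindices a) (S1 j + S2 j))%E in H.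
have S0 : (0 <= S)%E.
  rewrite /S fsbig_finite; last exact: finite_mindices.
  by apply: sume_ge0 => j _; exact: adde_ge0.
have SS j : mindices a j -> (S1 j + S2 j <= S)%E.
  move=> ja; rewrite /S (fsbigD1 j)//; last exact: finite_mindices.
  rewrite leeDl// fsbig_finite; last by apply: finite_setIl; exact: finite_mindices.
  by apply: sume_ge0 => i _; exact: adde_ge0.
have Sfin : S = (fine S)%:E by rewrite fineK// ge0_fin_numE.
exists (fine S); first by rewrite fine_ge0.
move=> j ja; have {}SS := SS j ja; split=> [x Fx|x y Fx Fy].
  rewrite -lee_fin -Sfin; apply: le_trans SS; apply: (@le_trans _ _ (S1 j)).
    by apply: ereal_sup_ubound; exists x.
  by rewrite leeDl.
(* On the diagonal the power may be zero, so it cannot be cleared from the quotient; the remainder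
   vanishes there. *)
have [->|xy] := eqVneq x y.
  by rewrite remainder_diag// normr0 mulr_ge0 ?powR_ge0// fine_ge0.
rewrite -ler_pdivrMr ?powR_gt0 ?eucl_dist_gt0// -lee_fin -Sfin.
apply: le_trans SS; apply: (@le_trans _ _ (S2 j)); last by rewrite leeDr.
by apply: ereal_sup_ubound; exists x => //; exists y.
Qed.

Lemma lip_norm_finite a F f L :
  (forall j, mindices a j ->
    (forall x, F x -> `|f j x| <= L) /\
    (forall x y, F x -> F y ->
       `|remainder a f j y x| <= L * eucl_dist x y `^ (a - (mdegree j)%:R))) ->
  (lip_norm a F f < +oo)%E.
Proof.
move=> H; rewrite /lip_norm fsbig_finite; last exact: finite_mindices.
rewrite big_seq; apply: lte_sum_pinfty => j.
rewrite in_fset_set; last exact: finite_mindices.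
rewrite inE => /H[H1 H2].
rewrite lte_add_pinfty//.
  apply: le_lt_trans (ltry L); apply: ge_ereal_sup => _ [x Fx <-].
  by rewrite lee_fin; exact: H1.
apply: le_lt_trans (ltry `|L|); apply: ge_ereal_sup => _ [x Fx [y Fy <-]].
have := H2 x y Fx Fy; have := powR_ge0 (eucl_dist x y) (a - (mdegree j)%:R).
(* If the power is zero, the quotient is zero by the convention on inverses. *)
rewrite lee_fin le_eqVlt => /predU1P[<-|p0] Hr; first by rewrite invr0 mulr0.
by rewrite ler_pdivrMr//; apply: le_trans Hr _; rewrite ler_pM2r// ler_norm.
Qed.

Lemma powR_subnatK (rho a : R) (m : nat) : 0 < rho -> rho `^ (a - m%:R) * rho ^+ m = rho `^ a.
Proof.
move=> r0; rewrite -powR_mulrn ?ltW// -powRD ?subrK//.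
by rewrite lt0r_neq0// implybT.
Qed.

(** Polynomials of degree at most [a] are described by their vanishing higher derivatives, a
    condition that passes to differences without handling coefficients. *)
Definition degree_le a (Q : 'rV[R]_n -> R) := forall s z, a < (size s)%:R -> partials s Q z = 0.

(** An instance of [deriv_bound_transfer] in which the top order vanishes on the whole ball; for the
    same reason the order [m] is arbitrary. *)
Lemma deriv_bound_polynomial a (Q : 'rV[R]_n -> R) e x rho A m :
  0 <= a -> smooth_on setT Q -> degree_le a Q -> 0 < rho -> eucl_dist x e <= rho ->
  deriv_bound (Num.truncn a) e rho A Q ->
  deriv_bound m x rho ((1 + n%:R) ^+ (Num.truncn a).+1 * A) Q.
Proof.
move=> a0 sQ dQ rho0 xe be; have A0 := deriv_bound_ge0 be.
have K0 : 0 <= (1 + n%:R : R) ^+ (Num.truncn a).+1 * A.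
  by rewrite mulr_ge0// exprn_ge0// addr_ge0.
have top s z : (Num.truncn a < size s)%N -> partials s Q z = 0.
  by move=> sa; apply: dQ; rewrite -truncn_lt_nat.
have bx : deriv_bound (Num.truncn a).+1 x rho ((1 + n%:R) ^+ (Num.truncn a).+1 * A) Q.
  apply: (deriv_bound_transfer sQ rho0 (fun _ _ => I) xe be) => s z sz _.
  by rewrite top ?sz// normr0 mul0r.
move=> s sm; have [sa|sa] := leqP (size s) (Num.truncn a).+1; first exact: bx.
by rewrite top ?normr0 ?mul0r// (leq_trans _ sa).
Qed.

Lemma degree_le_taylor a f y : degree_le a (taylor a f y).
Proof. by move=> s z; exact: partials_taylor_eq0. Qed.

Lemma smooth_taylorT a f y : smooth_on setT (taylor a f y).
Proof. by apply: smooth_taylor; exact: openT. Qed.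

Lemma degree_leB a (P Q : 'rV[R]_n -> R) : smooth_on setT P -> smooth_on setT Q ->
  degree_le a P -> degree_le a Q -> degree_le a (fun z => P z - Q z).
Proof.
move=> sP sQ dP dQ s z sa; rewrite (partialsB openT s I sP sQ).
by rewrite dP// dQ// subrr.
Qed.

Lemma deriv_bound_taylor a f y rho L : 0 <= a -> 1 <= rho ->
  (forall j, mindices a j -> `|f j y| <= L) ->
  deriv_bound (Num.truncn a) y rho (L * rho ^+ Num.truncn a) (taylor a f y).
Proof.
move=> a0 rho1 fL s sa; have sa' : (size s)%:R <= a by rewrite -truncn_ge_nat.
rewrite partials_taylor_diag//; apply: ler_pM => //.
- by rewrite exprn_ge0// (le_trans ler01).
- apply: fL; rewrite /mindices /= mdegree_madd mdegree_mzero add0n.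
  exact: sa'.
- by apply: ler_weXn2l.
Qed.

(** At [e] itself the derivatives of this difference are, up to sign, the remainders of the jet
    between [y] and [e]. *)
Lemma deriv_bound_taylorB a F f L : 0 <= a ->
  (forall j, mindices a j -> forall x y, F x -> F y ->
     `|remainder a f j y x| <= L * eucl_dist x y `^ (a - (mdegree j)%:R)) ->
  0 <= L ->
  forall y e rho, F y -> F e -> 0 < rho -> eucl_dist e y <= rho ->
  deriv_bound (Num.truncn a) e rho (L * rho `^ a) (fun z => taylor a f y z - taylor a f e z).
Proof.
move=> a0 fL L0 y e rho Fy Fe rho0 ye s sa.
have sa' : (size s)%:R <= a by rewrite -truncn_ge_nat.
have jE : mdegree (madd mzero s) = size s by rewrite mdegree_madd mdegree_mzero.
rewrite (partialsB openT s I (smooth_taylorT _ _ _) (smooth_taylorT _ _ _)).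
rewrite (partials_taylor_diag f e sa') (partials_Dmulti s openT (smooth_taylorT a f y) I).
rewrite distrC -(powR_subnatK a (size s) rho0) mulrA; apply: ler_wpM2r.
  by rewrite exprn_ge0// ltW.
have ja : mindices a (madd mzero s) by rewrite /mindices /= jE.
apply: (le_trans (fL _ ja e y Fe Fy)); rewrite jE; apply: ler_wpM2l => //.
by apply: ge0_ler_powR; rewrite ?nnegrE ?subr_ge0 ?eucl_dist_ge0// ltW.
Qed.

Lemma deriv_bound_unit m x d C (u : 'rV[R]_n -> R) : 0 < d -> d <= 1 ->
  deriv_bound m x d C u -> deriv_bound m x 1 (C / d ^+ m) u.
Proof.
move=> d0 d1 bu s sm; rewrite expr1n mulr1 ler_pdivlMr ?exprn_gt0//.
apply: le_trans (bu s sm); apply: ler_wpM2l => //.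
by apply: ler_wiXn2l => //; exact: ltW.
Qed.

End LipschitzJets.

(** * The extension operator *)

Section ExtensionEstimates.
Context {R : realType} {n : nat} (mu : probability (borel R n) R).
Variables (E : set 'rV[R]_n) (upsilon alpha q : R).
Variable f : multiindex n -> 'rV[R]_n -> R.
Hypothesis cE : compact E.
Hypothesis alpha_gt0 : 0 < alpha.
Hypothesis mu_on_E : mu E = 1%E.
Hypothesis mu_support : forall (x : 'rV[R]_n) (r : R), E x -> 0 < r ->
  (0 < mu (E `&` mball eucl_dist x r))%E.
Hypothesis mu_U : U_class (T := borel R n) eucl_dist E mu upsilon.
Hypothesis f_jet : is_jet alpha E f.
Hypothesis q_gt : upsilon + alpha < q.
Variable L : R.
Hypothesis L_ge0 : 0 <= L.
Hypothesis f_bound : forall j, mindices alpha j -> forall x, E x -> `|f j x| <= L.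
Hypothesis f_remainder : forall j, mindices alpha j -> forall x y, E x -> E y ->
  `|remainder alpha f j y x| <= L * eucl_dist x y `^ (alpha - (mdegree j)%:R).

Let mE : measurable (E : set (borel R n)) := compact_measurable_borel cE.
Let U := ~` E.
Let p := Num.truncn alpha.
Let T y := taylor alpha f y.
Let h := h_kernel E mu q.
Let ext := extension E mu q alpha f.
Let a0 : 0 <= alpha := ltW alpha_gt0.

Let upsilon0 : 0 <= upsilon.
Proof. exact: (upsilon_ge0 cE mu_on_E mu_support mu_U). Qed.

Let q_gt0 : 0 < q.
Proof. by apply: le_lt_trans q_gt; rewrite addr_ge0. Qed.

Lemma open_complement : open U.
Proof. by apply: closed_openC; apply: compact_closed cE; exact: norm_hausdorff. Qed.

Let oU := open_complement.

Definition nearest x e := E e /\ forall z, E z -> eucl_dist x e <= eucl_dist x z.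

Lemma exists_nearest x : exists e, nearest x e.
Proof.
have [e Ee emin] : exists2 e, e \in E & forall z, z \in E -> eucl_dist x e <= eucl_dist x z.
  apply: EVT_min_rV => //; first exact: (E_nonempty mu_on_E).
  by apply: continuous_subspaceT; exact: eucl_dist_continuousr.
by rewrite inE in Ee; exists e; split=> // z Ez; apply: emin; rewrite inE.
Qed.

Lemma nearest_gt0 x e : U x -> nearest x e -> 0 < eucl_dist x e.
Proof.
by move=> Ux [Ee _]; rewrite eucl_dist_gt0; apply: contra_notN Ux => /eqP ->.
Qed.

Lemma dist_bounded x : exists2 D, 1 <= D & forall y, E y -> eucl_dist x y <= D.
Proof.
have [e Ee emax] : exists2 e, e \in E & forall z, z \in E -> eucl_dist x z <= eucl_dist x e.
  apply: EVT_max_rV => //; first exact: (E_nonempty mu_on_E).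
  by apply: continuous_subspaceT; exact: eucl_dist_continuousr.
exists (Num.max 1 (eucl_dist x e)); first by rewrite le_max lexx.
by move=> y Ey; rewrite le_max emax ?orbT// inE.
Qed.

Lemma locally_away x : U x -> exists2 delta : R, 0 < delta <= 1 &
  forall z, eucl_dist z x <= delta -> U z /\ forall y, E y -> delta <= eucl_dist z y.
Proof.
move=> Ux; have [r r0 rU] := open_eucl_ball oU Ux.
(* Half of [r] is spent on the move from [x] to [z], the other half is the distance kept from [E].
   The cap [1] allows [deriv_bound_unit] to be applied. *)
pose delta := Num.min (r / 2) 1.
have d0 : 0 < delta by rewrite lt_min divr_gt0//= ltr01.
have dr : delta <= r / 2 by rewrite ge_min lexx.
exists delta; first by rewrite d0 ge_min lexx orbT.
move=> z zx; split=> [|y Ey].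
  by apply: rU; apply: le_trans zx _; apply: le_trans dr _; rewrite ler_piMr ?(ltW r0)// invf_le1// ler1n.
rewrite leNgt; apply/negP => zy; suff: U y by [].
apply: rU; apply: le_trans (eucl_dist_triangle z _ _) _.
rewrite [leRHS]splitr (eucl_distC y); apply: lerD; last exact: le_trans zx dr.
exact: le_trans (ltW zy) dr.
Qed.

(** Conditions under which [Q y x |x - y|^-q] is a smooth kernel. They are used for the Taylor
    polynomials [T y], the differences [T y - T e] and the constant [1], which yields [h]. *)
Definition locally_bounded_family (Q : 'rV[R]_n -> 'rV[R]_n -> R) :=
  [/\ forall y, E y -> smooth_on setT (Q y),
      forall x, measurable_fun (E : set (borel R n)) ((Q^~ x) : borel R n -> R) &
      forall m x, exists2 M, 0 <= M & forall z y, eucl_dist z x <= 1 -> E y ->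
        deriv_bound m z 1 M (Q y)].

Lemma smooth_dist_powU y (r : R) : E y -> smooth_on U (fun z => eucl_dist z y `^ r).
Proof. by move=> Ey; apply: smooth_dist_pow => //; exact. Qed.

Lemma smooth_kernel_family Q : locally_bounded_family Q ->
  smooth_kernel U E (fun x y => Q y x * eucl_dist x y `^ (- q)).
Proof.
move=> [sQ mQ bQ]; split=> [y Ey|x Ux|m x Ux].
- apply: smoothM => //; last exact: smooth_dist_powU.
  exact: smooth_subset (sQ y Ey).
- by apply: measurable_funM; [exact: mQ|exact: measurable_dist_pow].
have [delta /andP[d0 d1] dU] := locally_away Ux.
have [M M0 HM] := bQ m x; have [C C0 HC] := @deriv_bound_dist_pow _ _ U oU m (- q).
exists delta, (2 ^+ m * (M * (C * delta `^ (- q))) / delta ^+ m); split=> //.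
  by rewrite divr_ge0 ?mulr_ge0 ?exprn_ge0 ?powR_ge0// ltW.
move=> z zx; have [Uz zE] := dU z zx; split=> // y Ey.
apply: deriv_bound_unit => //.
apply: (@deriv_boundM _ _ U oU m z delta M _ (Q y)) => //.
- exact: smooth_subset (sQ y Ey).
- exact: smooth_dist_powU.
- by apply: deriv_bound_le (HM z y (le_trans zx d1) Ey) => //; exact: ltW.
apply: deriv_bound_le (HC z y delta Uz (fun Uy => Uy Ey) d0 (zE y Ey)) => //; first exact: ltW.
apply: ler_wpM2l => //; rewrite !powRN lef_pV2 ?posrE ?powR_gt0//.
  by apply: ge0_ler_powR; rewrite ?nnegrE ?(ltW q_gt0) ?(ltW d0) ?eucl_dist_ge0//; exact: zE.
exact: lt_le_trans (zE y Ey).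
Qed.

Lemma deriv_bound_Rintegral m x d (u : 'rV[R]_n -> 'rV[R]_n -> R) (v : 'rV[R]_n -> R) :
  smooth_kernel U E u -> U x -> 0 < d ->
  mu.-integrable E (EFin \o (v : borel R n -> R)) ->
  (forall y, E y -> deriv_bound m x d (v y) (u^~ y)) ->
  deriv_bound m x d (\int[mu]_(y in E) v y) (fun x => \int[mu]_(y in E) u x y).
Proof.
move=> ku Ux d0 iv bu s sm; rewrite (partials_Rintegral mu oU mE s ku Ux).
have ds0 : 0 < d ^+ size s by rewrite exprn_gt0.
rewrite -ler_pdivlMr// mulrC -RintegralZl//.
apply: normr_Rintegral_le => //.
- have ks : smooth_kernel U E (fun x y => partials s (u^~ y) x).
    exact: smooth_kernel_partials.
  exact: (smooth_kernel_integrable mu mE ks Ux).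
- exact: (integrableZl mE (d ^+ size s)^-1 iv).
by move=> y Ey; rewrite mulrC ler_pdivlMr//; exact: bu.
Qed.

Lemma measurable_taylor x : measurable_fun (E : set (borel R n)) ((fun y => T y x) : borel R n -> R).
Proof.
(* The guard gives every summand a measurable value: the jet is continuous only for indices of
   degree at most [alpha], while [measurable_sum] quantifies over all indices. *)
rewrite (_ : (fun y => T y x) = fun y => \sum_(j <- finmap.enum_fset (fset_set (@mindices n R alpha)))
    (if `[< mindices alpha j >] then (mfactorial j)%:R^-1 * f j y * mpower (x - y) j else 0)); last first.
  apply/funext => y; rewrite /T taylorE; apply: eq_big_seq => j.
  rewrite in_fset_set; last exact: finite_mindices.
  by rewrite inE => ja; rewrite asboolT.
apply: measurable_sum => j; case: asboolP => ja; last exact: measurable_cst.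
apply: measurable_funM.
  apply: measurable_funM; first exact: measurable_cst.
  by apply: within_continuous_measurable => //; exact: f_jet.
apply: continuous_measurable_borel => //.
have sm : smooth_on setT (fun z : 'rV[R]_n => mpower (z - x) j) by apply: smooth_mpower; exact: openT.
(* Exchanging [x] and [y] up to sign turns continuity in the base point into the known smoothness in
   the other variable. *)
rewrite (_ : (fun y => _) = (fun y => (-1) ^+ mdegree j * mpower (y - x) j)); last first.
  apply/funext => y; rewrite /mpower /mdegree -prodrXr -big_split /=.
  by apply: eq_bigr => i _; rewrite -exprMn !mxE mulN1r opprB.
move=> y.
exact: (smooth_continuous (smoothM openT (smooth_cst openT ((-1) ^+ mdegree j)) sm) I).
Qed.

Lemma taylor_locally_bounded m x : exists2 M, 0 <= M & forall z y, eucl_dist z x <= 1 -> E y ->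
  deriv_bound m z 1 M (T y).
Proof.
have [D D1 HD] := dist_bounded x.
have D10 : 0 < 1 + D by rewrite addr_gt0// (lt_le_trans _ D1).
have rho1 : 1 <= 1 + D by rewrite lerDl (le_trans _ D1).
exists ((1 + n%:R) ^+ p.+1 * (L * (1 + D) ^+ p)).
  apply: mulr_ge0; first by rewrite exprn_ge0// addr_ge0.
  by apply: mulr_ge0 => //; apply: exprn_ge0; exact: ltW.
move=> z y zx Ey; have zy : eucl_dist z y <= 1 + D.
  by apply: le_trans (eucl_dist_triangle x _ _) _; apply: lerD => //; exact: HD.
apply: (@deriv_bound_le _ _ m m z (1 + D) 1) => //.
apply: (@deriv_bound_polynomial _ _ alpha (T y) y z (1 + D) _ m) => //.
- exact: smooth_taylorT.
- exact: degree_le_taylor.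
by apply: deriv_bound_taylor => // j ja; exact: f_bound.
Qed.

Lemma taylor_family : locally_bounded_family T.
Proof.
split=> [y _|x|m x]; first exact: smooth_taylorT.
- exact: measurable_taylor.
- exact: taylor_locally_bounded.
Qed.

Lemma taylorB_family e : E e -> locally_bounded_family (fun y z => T y z - T e z).
Proof.
move=> Ee; split=> [y _|x|m x].
- by apply: smoothB; [exact: openT|exact: smooth_taylorT|exact: smooth_taylorT].
- by apply: measurable_funB; [exact: measurable_taylor|exact: measurable_cst].
have [M M0 HM] := taylor_locally_bounded m x.
exists (M + M); first by rewrite addr_ge0.
move=> z y zx Ey; apply: (deriv_boundB openT) => //; try exact: smooth_taylorT; exact: HM.
Qed.

Lemma cst_family : locally_bounded_family (fun _ _ => 1).
Proof.
split=> [y _|x|m x]; first by apply: smooth_cst; exact: openT.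
- exact: measurable_cst.
exists 1 => // z y _ _; have := @deriv_bound_cst _ _ setT openT m z 1 1 I.
by rewrite normr1.
Qed.

Lemma smooth_kernel_h : smooth_kernel U E (fun x y => eucl_dist x y `^ (- q)).
Proof.
have := smooth_kernel_family cst_family; congr (smooth_kernel _ _ _).
by apply/funext => x; apply/funext => y; rewrite mul1r.
Qed.

Lemma smooth_h : smooth_on U h.
Proof. exact: (smooth_Rintegral mu oU mE smooth_kernel_h). Qed.

Lemma h_gt0 x : U x -> 0 < h x.
Proof.
move=> Ux; have [e ne] := exists_nearest x; have [Ee eE] := ne.
exact: (dist_moment_gt0 cE mu_support (ltW q_gt0) Ee (nearest_gt0 Ux ne) eE).
Qed.

Lemma extensionE x : ext x = (h x)^-1 * \int[mu]_(y in E) (T y x * eucl_dist x y `^ (- q)).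
Proof. by congr (_ * _); apply: eq_Rintegral => y _; rewrite powRN. Qed.

Lemma smooth_extension : smooth_on U ext.
Proof.
apply: (eq_smooth oU (fun x _ => esym (extensionE x))); apply: smoothM => //.
  by apply: smoothV => //; [move=> x /h_gt0/lt0r_neq0|exact: smooth_h].
exact: (smooth_Rintegral mu oU mE (smooth_kernel_family taylor_family)).
Qed.

Lemma extension_subE e x : E e -> U x -> (h x)^-1 *
   \int[mu]_(y in E) ((T y x - T e x) * eucl_dist x y `^ (- q)) = ext x - T e x.
Proof.
move=> Ee Ux; rewrite extensionE.
have i1 := smooth_kernel_integrable mu mE (smooth_kernel_family taylor_family) Ux.
have i2 := smooth_kernel_integrable mu mE smooth_kernel_h Ux.
have i3 : mu.-integrable E (EFin \o (fun y => T e x * eucl_dist x y `^ (- q) : R)).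
  exact: (integrableZl mE (T e x) i2).
under eq_Rintegral do rewrite mulrBl.
rewrite RintegralB// RintegralZl// mulrBr [X in _ - X]mulrCA mulVf ?mulr1//.
exact/lt0r_neq0/h_gt0.
Qed.

(* [ext - T e] is the average of [T y - T e] against the weights
   [|x - y|^-q / h x], so its size is governed by the Lipschitz condition on [f]. *)
Lemma extension_near_taylor m : exists2 C, 0 <= C & forall x e, U x -> nearest x e ->
  deriv_bound m x (eucl_dist x e) (C * eucl_dist x e `^ alpha) (fun z => ext z - T e z).
Proof.
have [C C0 HC] := @deriv_bound_dist_pow _ _ U oU m (- q).
have [] := @deriv_boundV _ _ U oU m (Num.max 1 C); first by rewrite le_max lexx.
move=> K K1 HK.
(* The Lipschitz factor [|x - y|^alpha] lowers the exponent from [q] to [q - alpha]; [q_gt] keeps it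
   above [upsilon]. *)
have [M M0 HM] := @dist_moment_ratio _ _ mu E upsilon cE mu_on_E mu_support mu_U (q - alpha) q
  ltac:(by rewrite ltrBrDr) (ltW q_gt0).
pose Kn : R := (1 + n%:R) ^+ p.+1.
have Kn0 : 0 <= Kn by rewrite exprn_ge0// addr_ge0.
pose B := 2 ^+ m * (Kn * (L * 2 `^ alpha) * C).
have B0 : 0 <= B by rewrite !mulr_ge0 ?exprn_ge0 ?powR_ge0.
exists (2 ^+ m * (K * (B * M))).
  by rewrite !mulr_ge0 ?exprn_ge0// (le_trans _ K1).
move=> x e Ux ne; have [Ee eE] := ne; have d0 := nearest_gt0 Ux ne.
set d := eucl_dist x e in d0 eE *.
have h0 := h_gt0 Ux.
have k3 := smooth_kernel_family (taylorB_family Ee).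
have kh := smooth_kernel_h.
(* Each kernel is bounded with its derivatives by a multiple of itself, and integration turns this
   into a multiple of [h x]. *)
have bh : deriv_bound m x d (Num.max 1 C * h x) h.
  have C_h : C * h x <= Num.max 1 C * h x by rewrite ler_pM2r// le_max lexx orbT.
  apply: (deriv_bound_le (leqnn m) (ltW d0) (lexx d) C_h).
  rewrite /h /h_kernel -RintegralZl//; last exact: (smooth_kernel_integrable mu mE kh Ux).
  apply: deriv_bound_Rintegral => //.
    exact: (integrableZl mE C (smooth_kernel_integrable mu mE kh Ux)).
  by move=> y Ey; exact: (HC x y d Ux (fun Uy => Uy Ey) d0 (eE y Ey)).
have bV := HK x d h Ux d0 smooth_h (fun z Uz => h_gt0 Uz) bh.
have bA : deriv_bound m x d (B * (M * d `^ alpha * h x))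
    (fun x => \int[mu]_(y in E) ((T y x - T e x) * eucl_dist x y `^ (- q))).
  have iq : mu.-integrable E (EFin \o (fun y => eucl_dist x y `^ (- (q - alpha)) : R)).
    apply: (integrable_dist_pow mu cE d0 _ eE).
    by rewrite subr_ge0 ltW// (le_lt_trans _ q_gt)// lerDr.
  have := HM x e Ee d0 eE; rewrite -/d subKr -/(h_kernel E mu q x) -/(h x) => HM'.
  apply: (deriv_bound_le (leqnn m) (ltW d0) (lexx d) (ler_wpM2l B0 HM')).
  rewrite -RintegralZl//; apply: deriv_bound_Rintegral => //.
    exact: (integrableZl mE B iq).
  move=> y Ey; have xy0 : 0 < eucl_dist x y by exact: lt_le_trans (eE y Ey).
  (* The radius [2 |x - y|] covers both [|e - y|], for the Lipschitz condition, and [|x - e|], for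
     the passage from [e] to [x]. *)
  have rho0 : 0 < 2 * eucl_dist x y by rewrite mulr_gt0.
  have ey : eucl_dist e y <= 2 * eucl_dist x y.
    rewrite mulr_natl mulr2n; apply: le_trans (eucl_dist_triangle x _ _) _.
    by rewrite lerD2r eucl_distC; exact: eE.
  have dr : d <= 2 * eucl_dist x y.
    by apply: le_trans (eE y Ey) _; rewrite ler_peMl ?(ltW xy0)// ler1n.
  have bT := @deriv_bound_polynomial _ _ alpha (fun z => T y z - T e z) e x (2 * eucl_dist x y)
    _ m a0 (smoothB openT (smooth_taylorT _ _ _) (smooth_taylorT _ _ _))
    (degree_leB (smooth_taylorT _ _ _) (smooth_taylorT _ _ _) (@degree_le_taylor _ _ alpha f y)
       (@degree_le_taylor _ _ alpha f e)) rho0 dr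
    (deriv_bound_taylorB a0 f_remainder L_ge0 Ey Ee rho0 ey).
  have {}bT := deriv_bound_le (leqnn m) (ltW d0) dr (lexx _) bT.
  have sT : smooth_on U (fun z => T y z - T e z).
    by apply: smoothB => //; apply: smooth_taylor.
  have bM := deriv_boundM oU Ux d0 sT (smooth_dist_powU (- q) Ey) bT
    (HC x y d Ux (fun Uy => Uy Ey) d0 (eE y Ey)).
  apply: (deriv_bound_le (leqnn m) (ltW d0) (lexx d) _ bM).
  rewrite le_eqVlt; apply/orP; left; apply/eqP.
  rewrite opprB powRM ?eucl_dist_ge0// -/p -/Kn /B.
  have -> : eucl_dist x y `^ (alpha - q) = eucl_dist x y `^ alpha * eucl_dist x y `^ (- q).
    by rewrite powRD// lt0r_neq0// implybT.
  clearbody Kn; move: (2 ^+ m) (2 `^ alpha) (_ `^ alpha) (_ `^ (- q)) => b1 b2 b3 b4.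
  by ring.
have sV : smooth_on U (fun z => (h z)^-1).
  by apply: smoothV => //; [move=> z /h_gt0/lt0r_neq0|exact: smooth_h].
have bM := deriv_boundM oU Ux d0 sV (smooth_Rintegral mu oU mE k3) bV bA.
have {}bM := eq_deriv_bound oU Ux (fun z Uz => extension_subE Ee Uz) bM.
apply: (deriv_bound_le (leqnn m) (ltW d0) (lexx d) _ bM).
rewrite le_eqVlt; apply/orP; left; apply/eqP.
move: (d `^ alpha) (h x) h0 => b1 b2 b20.
by field; exact: lt0r_neq0.
Qed.

(** * Bounds and remainders of the extended jet *)

Let g := extended_jet E mu q alpha f.

(* The jet of [g] at [x] is the jet at [x] of the function [local_model x]. *)
Definition local_model (x : 'rV[R]_n) : 'rV[R]_n -> R := if x \in E then T x else ext.

Lemma partials_local_model x s : (size s)%:R <= alpha ->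
  partials s (local_model x) x = g (madd mzero s) x.
Proof.
move=> sa; rewrite /local_model /g /extended_jet; case: ifPn => Ex.
  by rewrite partials_taylor_diag.
by apply: (partials_Dmulti s oU smooth_extension); rewrite notin_setE in Ex.
Qed.

(** For orders up to [p] the exponent [alpha - size s] is nonnegative, so the distance to [E] may be
    replaced by any larger [rho]. Points of [E] are included: there [e = x] and the difference is
    zero. *)
Lemma local_model_near_taylor : exists2 C, 0 <= C & forall x e rho, nearest x e ->
  0 < rho -> eucl_dist x e <= rho -> forall s, (size s <= p)%N ->
  `|partials s (local_model x) x - partials s (T e) x| * rho ^+ size s <= C * rho `^ alpha.
Proof.
have [C C0 HC] := extension_near_taylor p; exists C => // x e rho ne rho0 xe s sp.
have [Ee eE] := ne; have rs0 : 0 < rho ^+ size s by rewrite exprn_gt0.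
rewrite /local_model; case: ifPn => Ex.
  have -> : e = x.
    apply/eqP; rewrite -[_ == _]negbK eq_sym -eucl_dist_gt0 -leNgt.
    by rewrite -(eucl_distxx x) eE// -in_setE.
  by rewrite subrr normr0 mul0r mulr_ge0// powR_ge0.
have Ux : U x by rewrite notin_setE in Ex.
have d0 := nearest_gt0 Ux ne; have := HC x e Ux ne s sp.
rewrite (partialsB oU s Ux smooth_extension (smooth_taylor _ _ _ oU)).
rewrite -(powR_subnatK alpha (size s) d0) -(powR_subnatK alpha (size s) rho0) !mulrA.
rewrite ler_pM2r ?exprn_gt0// => H; rewrite ler_pM2r//; apply: (le_trans H).
apply: ler_wpM2l => //; apply: ge0_ler_powR; rewrite ?nnegrE ?(ltW d0) ?(ltW rho0)//.
by rewrite subr_ge0 -truncn_ge_nat.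
Qed.

Let Kn : R := (1 + n%:R) ^+ p.+1.

Let Kn0 : 0 <= Kn.
Proof. by rewrite exprn_ge0// addr_ge0. Qed.

Lemma remainder_near : exists2 C, 0 <= C & forall x y ex ey, nearest x ex -> nearest y ey ->
  0 < eucl_dist x y -> eucl_dist x ex <= 4 * eucl_dist x y ->
  eucl_dist y ey <= 4 * eucl_dist x y -> forall s, (size s <= p)%N ->
  `|partials s (local_model x) x - partials s (taylor alpha g y) x| *
    eucl_dist x y ^+ size s <= C * eucl_dist x y `^ alpha.
Proof.
have [C C0 HC] := local_model_near_taylor.
pose B := C + Kn * L + Kn * C.
have B0 : 0 <= B by rewrite !addr_ge0 ?mulr_ge0.
exists (B * 10 `^ alpha); first by rewrite mulr_ge0 ?powR_ge0.
move=> x y ex ey nx ny r0 dx dy s sp.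
have [Eex _] := nx; have [Eey _] := ny.
(* A common radius for all comparisons: [x] to [ex] and [y] to [ey] are within [4 r], [x] to [ey]
   within [5 r], and [ex] to [ey] within [9 r]. *)
set r := eucl_dist x y in r0 dx dy *; pose rho := 10 * r.
have rho0 : 0 < rho by rewrite mulr_gt0.
have le10 (c : R) : c <= 10 -> c * r <= rho by move=> c10; rewrite ler_pM2r.
have yrho : eucl_dist x y <= rho by rewrite -[leLHS]mul1r le10// ler1n.
have xeyrho : eucl_dist x ey <= 5 * r.
  apply: le_trans (eucl_dist_triangle y _ _) _; rewrite -/r.
  by move: dy; move: (eucl_dist y ey) r {r0 dx le10 yrho rho rho0} => b c; lra.
have eyrho : eucl_dist ey ex <= rho.
  apply: (@le_trans _ _ (9 * r)); last by rewrite le10// ler_nat.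
  apply: le_trans (eucl_dist_triangle x _ _) _; rewrite eucl_distC.
  move: xeyrho dx; move: (eucl_dist x ex) (eucl_dist x ey) r {r0 dy le10 yrho rho rho0}.
  by move=> a b c; lra.
have b1 := HC x ex rho nx rho0 (le_trans dx (le10 4 (ltac:(by rewrite ler_nat)))) s sp.
have b2 := @deriv_bound_polynomial _ _ alpha (fun z => T ex z - T ey z) ey x rho
    _ p a0 (smoothB openT (smooth_taylorT _ _ _) (smooth_taylorT _ _ _))
    (degree_leB (smooth_taylorT _ _ _) (smooth_taylorT _ _ _) (@degree_le_taylor _ _ alpha f ex)
       (@degree_le_taylor _ _ alpha f ey)) rho0
    (le_trans xeyrho (le10 5 (ltac:(by rewrite ler_nat))))
    (deriv_bound_taylorB a0 f_remainder L_ge0 Eex Eey rho0 eyrho) s sp.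
(* The estimate holds at [y], where the derivatives of the second polynomial are the values of [g];
   since both are polynomials, it carries over to [x]. *)
have b30 : deriv_bound p y rho (C * rho `^ alpha) (fun z => T ey z - taylor alpha g y z).
  move=> t tp; have ta : (size t)%:R <= alpha by rewrite -truncn_ge_nat.
  rewrite (partialsB openT t I (smooth_taylorT _ _ _) (smooth_taylorT _ _ _)).
  rewrite (partials_taylor_diag g y ta) -(partials_local_model y ta) distrC.
  exact: (HC y ey rho ny rho0 (le_trans dy (le10 4 (ltac:(by rewrite ler_nat)))) t tp).
have b3 := @deriv_bound_polynomial _ _ alpha (fun z => T ey z - taylor alpha g y z) y x rho
    _ p a0 (smoothB openT (smooth_taylorT _ _ _) (smooth_taylorT _ _ _))
    (degree_leB (smooth_taylorT _ _ _) (smooth_taylorT _ _ _) (@degree_le_taylor _ _ alpha f ey)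
       (@degree_le_taylor _ _ alpha g y)) rho0 yrho b30 s sp.
rewrite (partialsB openT s I (smooth_taylorT _ _ _) (smooth_taylorT _ _ _)) -/p -/Kn in b2.
rewrite (partialsB openT s I (smooth_taylorT _ _ _) (smooth_taylorT _ _ _)) -/p -/Kn in b3.
have -> : B * 10 `^ alpha * r `^ alpha =
    C * rho `^ alpha + Kn * (L * rho `^ alpha) + Kn * (C * rho `^ alpha).
  rewrite /rho powRM ?(ltW r0)// /B; clear.
  by move: (10 `^ alpha) (r `^ alpha) Kn => b c K; ring.
apply: le_trans (lerD (lerD b1 b2) b3); rewrite -!mulrDl; apply: ler_pM => //.
- by rewrite exprn_ge0// ltW.
- apply: le_trans (ler_distD (partials s (T ey) x) _ _) _; rewrite lerD2r.
  exact: ler_distD.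
by rewrite lerXn2r// nnegrE ltW.
Qed.

(** At [y] the difference of [ext] and its Taylor polynomial vanishes to order [p], and on the ball
    its derivatives of order [p.+1] are those of [ext]; [deriv_bound_transfer] concludes. *)
Lemma remainder_far : exists2 C, 0 <= C & forall x y ey, nearest y ey ->
  0 < eucl_dist x y -> 3 * eucl_dist x y < eucl_dist y ey -> forall s, (size s <= p)%N ->
  `|partials s (local_model x) x - partials s (taylor alpha g y) x| *
    eucl_dist x y ^+ size s <= C * eucl_dist x y `^ alpha.
Proof.
have [C C0 HC] := extension_near_taylor p.+1.
exists (Kn * C); first by rewrite mulr_ge0.
move=> x y ey [_ eyE] r0 yr s sp; set r := eucl_dist x y in r0 yr *.
have far z e : eucl_dist z y <= r -> E e -> 2 * r < eucl_dist z e.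
  move=> zy Ee; have := lt_le_trans yr (eyE e Ee).
  have := eucl_dist_triangle z y e; rewrite (eucl_distC y z); move: zy.
  by move: (eucl_dist z y) (eucl_dist z e) (eucl_dist y e) r {r0 yr} => a b c d; lra.
have r2 : r <= 2 * r by rewrite ler_peMl ?(ltW r0)// ler1n.
have ballU z : eucl_dist z y <= r -> U z.
  move=> zy Ez; have := far z z zy Ez; rewrite eucl_distxx ltNge => /negP; apply.
  by rewrite mulr_ge0// ltW.
have Ux : U x by exact: ballU.
have Uy : U y by apply: ballU; rewrite eucl_distxx ltW.
have lmE z : U z -> local_model z = ext.
  by move=> Uz; rewrite /local_model ifN// notin_setE.
have sTg : smooth_on U (taylor alpha g y) by exact: smooth_taylor.
have A0 : 0 <= C * r `^ alpha by rewrite mulr_ge0 ?powR_ge0.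
have by0 : deriv_bound p y r (C * r `^ alpha) (fun z => ext z - taylor alpha g y z).
  move=> t tp; have ta : (size t)%:R <= alpha by rewrite -truncn_ge_nat.
  rewrite (partialsB oU t Uy smooth_extension sTg) (partials_taylor_diag g y ta).
  by rewrite -(partials_local_model y ta) lmE// subrr normr0 mul0r.
have top t z : size t = p.+1 -> eucl_dist z y <= r ->
    `|partials t (fun z => ext z - taylor alpha g y z) z| * r ^+ p.+1 <= C * r `^ alpha.
  move=> tp zy; have Uz := ballU z zy.
  have ta : alpha < (size t)%:R by rewrite tp truncnS_gt.
  rewrite (partialsB oU t Uz smooth_extension sTg) (partials_taylor_eq0 _ _ _ ta) subr0.
  have [e ne] := exists_nearest z; have [Ee _] := ne; have d0 := nearest_gt0 Uz ne.
  have := HC z e Uz ne t; rewrite tp leqnn => /(_ isT).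
  rewrite (partialsB oU t Uz smooth_extension (smooth_taylor _ _ _ oU)).
  rewrite (partials_taylor_eq0 _ _ _ ta) subr0.
  move: (partials t ext z) => w H.
  have {}H : `|w| <= C * eucl_dist z e `^ (alpha - p.+1%:R).
    by rewrite -(ler_pM2r (exprn_gt0 p.+1 d0)) -mulrA powR_subnatK.
  rewrite -(powR_subnatK alpha p.+1 r0) mulrA; apply: ler_wpM2r; first by rewrite exprn_ge0// ltW.
  apply: (le_trans H); apply: ler_wpM2l => //.
  (* The exponent is negative, so the lower bound on the distance from the ball to [E] gives an
     upper bound here. *)
  have -> : alpha - p.+1%:R = - (p.+1%:R - alpha) by rewrite opprB.
  rewrite !powRN lef_pV2 ?posrE ?powR_gt0//.
  apply: ge0_ler_powR; rewrite ?nnegrE ?(ltW d0) ?(ltW r0)//.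
    by rewrite subr_ge0 -tp ltW.
  exact: le_trans r2 (ltW (far z e zy Ee)).
have := deriv_bound_transfer (smoothB oU smooth_extension sTg) r0 ballU (lexx _) by0 top.
move=> /(_ s (leq_trans sp (leqnSn p))).
by rewrite (partialsB oU s Ux smooth_extension sTg) (lmE x Ux) -/Kn mulrA.
Qed.

Lemma extended_jet_remainder : exists2 C, 0 <= C & forall j, mindices alpha j -> forall x y,
  `|remainder alpha g j y x| <= C * eucl_dist x y `^ (alpha - (mdegree j)%:R).
Proof.
have [C C0 HC] := remainder_near; have [C' C'0 HC'] := remainder_far.
exists (Num.max C C'); first by rewrite le_max C0.
move=> j ja x y; have [->|xy] := eqVneq x y.
  by rewrite remainder_diag// normr0 mulr_ge0 ?powR_ge0// le_max C0.
have r0 : 0 < eucl_dist x y by rewrite eucl_dist_gt0.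
have sa : (size (mseq j))%:R <= alpha by rewrite size_mseq.
have sp : (size (mseq j) <= p)%N by rewrite truncn_ge_nat.
rewrite -(ler_pM2r (_ : 0 < eucl_dist x y ^+ mdegree j)) ?exprn_gt0//.
rewrite -mulrA powR_subnatK// -size_mseq.
have -> : remainder alpha g j y x = partials (mseq j) (local_model x) x -
    partials (mseq j) (taylor alpha g y) x.
  by rewrite /remainder partials_local_model// madd_mseq.
have maxC (c : R) : c = C \/ c = C' ->
    c * eucl_dist x y `^ alpha <= Num.max C C' * eucl_dist x y `^ alpha.
  by move=> cC; rewrite ler_wpM2r ?powR_ge0// le_max; case: cC => ->; rewrite lexx ?orbT.
have [ex nx] := exists_nearest x; have [ey ny] := exists_nearest y.
(* If [y] is within three times [|x - y|] of [E], then [x] is within four times, as [remainder_near]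
   requires. *)
have [yfar|ynear] := ltP (3 * eucl_dist x y) (eucl_dist y ey).
  apply: le_trans (maxC _ (or_intror erefl)); exact: HC' ny r0 yfar _ sp.
apply: le_trans (maxC _ (or_introl erefl)); apply: (HC x y ex ey) => //.
  have [_ exE] := nx; have [Eey _] := ny.
  apply: (le_trans (exE ey Eey)); apply: le_trans (eucl_dist_triangle y _ _) _.
  by move: ynear; move: (eucl_dist y ey) (eucl_dist x y) => a b; lra.
by move: ynear r0; move: (eucl_dist y ey) (eucl_dist x y) => a b; lra.
Qed.

Lemma extended_jet_bounded r : exists M, forall j, mindices alpha j -> forall x,
  mball eucl_dist 0 r x -> `|g j x| <= M.
Proof.
have [C C0 HC] := local_model_near_taylor.
have [D D1 HD] := dist_bounded 0; have [e0 Ee0] := E_nonempty mu_on_E.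
(* This bounds the distance to [E] from every point of the ball; being at least [1], it also allows
   the weight [rho ^+ size s] to be dropped. *)
pose rho := D + `|r|.
have rho1 : 1 <= rho by rewrite ler_wpDr.
have rho0 : 0 < rho by exact: lt_le_trans rho1.
exists (C * rho `^ alpha + Kn * (L * rho ^+ p)) => j ja x xr.
have sa : (size (mseq j))%:R <= alpha by rewrite size_mseq.
have sp : (size (mseq j) <= p)%N by rewrite truncn_ge_nat.
have [e ne] := exists_nearest x; have [Ee eE] := ne.
have xe : eucl_dist x e <= rho.
  apply: le_trans (eucl_dist_triangle 0 _ _) _; rewrite addrC; apply: lerD; first exact: HD.
  by rewrite eucl_distC; apply: ltW; apply: lt_le_trans xr _; exact: ler_norm.
have b1 := HC x e rho ne rho0 xe (mseq j) sp.
have bT : deriv_bound p e rho (L * rho ^+ p) (T e).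
  by apply: deriv_bound_taylor => // i ia; exact: f_bound.
have b2 := @deriv_bound_polynomial _ _ alpha (T e) e x rho _ p a0 (smooth_taylorT _ _ _) (@degree_le_taylor _ _ alpha f e)
  rho0 xe bT (mseq j) sp.
rewrite -/p -/Kn in b2.
have -> : g j x = partials (mseq j) (local_model x) x by rewrite partials_local_model// madd_mseq.
apply: le_trans (lerD b1 b2); rewrite -mulrDl.
apply: (@le_trans _ _ (`|partials (mseq j) (local_model x) x - partials (mseq j) (T e) x| +
   `|partials (mseq j) (T e) x|)).
  by rewrite -{1}[partials (mseq j) (local_model x) x](subrK (partials (mseq j) (T e) x)) ler_normD.
by rewrite ler_peMr ?addr_ge0// exprn_ege1.
Qed.

(** Strict inequality makes the exponent of the remainder bound positive: near [y], the function
    [g j] differs from a polynomial by a quantity tending to zero. *)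
Lemma extended_jet_continuous j : (mdegree j)%:R < alpha -> continuous (g j).
Proof.
move=> ja y; have [C C0 HC] := extended_jet_remainder.
set c := alpha - (mdegree j)%:R; have c0 : 0 < c by rewrite subr_gt0.
have P : 0 < C + 1 by rewrite ltr_wpDl.
apply/(@cvgrPdist_le _ _ _ (nbhs y)) => eps eps0.
have eps20 : 0 < eps / 2 by rewrite divr_gt0.
have Tc : {for y, continuous (Dmulti j (taylor alpha g y))}.
  by apply: (@smooth_continuous _ _ setT) => //; apply: smooth_partials; exact: smooth_taylorT.
have Tyy : Dmulti j (taylor alpha g y) y = g j y.
  by rewrite /Dmulti -[flatten _]/(mseq j) partials_taylor_diag ?madd_mseq// size_mseq ltW.
move/(@cvgrPdist_le _ _ _ (nbhs y)) : Tc => /(_ _ eps20) N0.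
(* Solves [(C + 1) t^c = eps / 2]; the added [1] covers [C = 0]. *)
pose t := (eps / 2 / (C + 1)) `^ c^-1.
have t0 : 0 < t by rewrite powR_gt0// divr_gt0.
apply: filterS2 N0 (near_eucl_dist y t0) => x; rewrite Tyy => N1 xy.
have -> : g j y - g j x = (g j y - Dmulti j (taylor alpha g y) x) - remainder alpha g j y x.
  by rewrite /remainder opprB addrA subrK.
apply: le_trans (ler_normB _ _) _; rewrite [leRHS]splitr; apply: lerD => //.
apply: le_trans (HC j (ltW ja) x y) _; rewrite -/c.
have xc : eucl_dist x y `^ c <= eps / 2 / (C + 1).
  have -> : eps / 2 / (C + 1) = t `^ c.
    by rewrite /t -powRrM mulVf ?lt0r_neq0// powRr1// divr_ge0// ltW.
  by apply: ge0_ler_powR; rewrite ?nnegrE ?eucl_dist_ge0 ?(ltW c0) ?(ltW t0) ?(ltW xy).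
apply: (@le_trans _ _ ((C + 1) * eucl_dist x y `^ c)).
  by rewrite ler_wpM2r ?powR_ge0// lerDl.
by rewrite -ler_pdivlMl// mulrC.
Qed.

Lemma extended_jet_lip_norm (r : R) :
  (lip_norm alpha (mball eucl_dist (0%R : 'rV[R]_n) r) g < +oo)%E.
Proof.
have [C C0 HC] := extended_jet_remainder; have [M HM] := extended_jet_bounded r.
apply: (@lip_norm_finite _ _ _ _ _ (Num.max M C)) => j ja; split=> [x xr|x y _ _].
  by rewrite le_max (HM j ja x xr).
apply: le_trans (HC j ja x y) _.
by rewrite ler_wpM2r ?powR_ge0// le_max lexx orbT.
Qed.

End ExtensionEstimates.

Unset Implicit Arguments.
Set Strict Implicit.

Theorem theorem4 (R : realType) (n : nat) (E : set 'rV[R]_n)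
    (alpha upsilon q : R) (mu : probability (borel R n) R)
    (f : multiindex n -> 'rV[R]_n -> R)
    (E_compact : compact E)
    (alpha_gt0 : 0 < alpha)
    (upsilon_ge : (upper_dim eucl_dist E <= upsilon%:E)%E)
    (mu_on_E : mu E = 1%E)
    (mu_support : forall (x : 'rV[R]_n) (r : R), E x -> 0 < r ->
       (0 < mu (E `&` mball eucl_dist x r))%E)
    (mu_U : U_class (T := borel R n) eucl_dist E mu upsilon)
    (f_Lip : Lip alpha E f)
    (q_gt : upsilon + alpha < q) :
  smooth_on (~` E) (extension E mu q alpha f) /\
  forall r : R, 0 < r ->
    let B := mball eucl_dist (0 : 'rV[R]_n) r in
    let g := extended_jet E mu q alpha f in
    [/\ (lip_norm alpha B g < +oo)%E,
        (forall j : multiindex n, (mdegree j)%:R < alpha ->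
           {within B, continuous (g j)})
      & (alpha \isn't a Num.nat -> Lip alpha B g)].
Proof.
have [f_jet /lip_norm_bound[L L0 HL]] := f_Lip.
have f_bound j (ja : mindices alpha j) := (HL j ja).1.
have f_rem j (ja : mindices alpha j) := (HL j ja).2.
split.
  exact: (smooth_extension E_compact alpha_gt0 mu_on_E mu_support mu_U f_jet q_gt L0 f_bound).
move=> r r0 B g.
have gL : (lip_norm alpha B g < +oo)%E.
  exact: (extended_jet_lip_norm E_compact alpha_gt0 mu_on_E mu_support mu_U f_jet q_gt L0 f_bound f_rem).
have gC j : (mdegree j)%:R < alpha -> {within B, continuous (g j)}.
  move=> ja; apply: continuous_subspaceT.
  exact: (extended_jet_continuous E_compact alpha_gt0 mu_on_E mu_support mu_U f_jet q_gt L0 f_bound f_rem ja).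
split=> // alpha_nat; split=> // j ja; apply: gC.
(* For [alpha] not a natural number, degree at most [alpha] means degree below [alpha]. *)
rewrite lt_neqAle ja andbT; apply: contra alpha_nat => /eqP <-; exact: natr_nat.
Qed.
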